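(* Every finitely generated right-angled Artin group is (isomorphic to) a direct product of finitely many factors, each of which is either a cyclic group or a right-angled Artin group all of whose infinite-index convex-cocompact subgroups are $\mathcal{A}$-separable (in that factor).
   Context: The right-angled Artin group associated to a simplicial graph $\mathcal{G}$ is $A(\mathcal{G})=\langle g_v,\ v\in V(\mathcal{G}) \mid g_ug_v=g_vg_u \text{ for } \{u,v\}\in E(\mathcal{G})\rangle$. The Salvetti complex $X(\mathcal{G})$ is the cube complex with vertex set $A(\mathcal{G})$ in which, for each $g\in A(\mathcal{G})$ and each set of distinct pairwise commuting generators $g_{u_1},\dots,g_{u_n}$, there is a unique $n$-cube with vertex set $\{g\prod_{j\in P}g_{u_j} : P\subset\{1,\dots,n\}\}$. $A(\mathcal{G})$ acts on it by left multiplication. A subcomplex $Y$ of a cube complex $X$ is convex if every geodesic of the 1-skeleton $X^{(1)}$ (edge-path metric) with endpoints in $Y$ is contained in $Y$. A subgroup $K$ of $A(\mathcal{G})$ is convex-cocompact if there is a non-empty convex subcomplex $Y\subset X(\mathcal{G})$ that is invariant under $K$ and on which $K$ acts cocompactly. A subgroup $H$ of a finitely generated group $G$ is $\mathcal{A}$-separable (in $G$) if for any finite set $\{\gamma_1,\dots,\gamma_m\}\subset G\setminus H$ there is a surjective homomorphism $f$ from $G$ onto a finite alternating group such that $f(\gamma_i)\notin f(H)$ for all $i$. *)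

(* Defs.v *)
From HB Require Import structures.
From mathcomp Require Import all_boot perm alt.
From mathcomp Require Import boolp classical_sets functions cardinality.

Set Implicit Arguments.
Unset Strict Implicit.
Unset Printing Implicit Defensive.

Local Open Scope classical_set_scope.
Local Open Scope group_scope.
Local Open Scope quotient_scope.

Definition subgroup (G : groupType) (H : set G) : Prop :=
  group_closed (mem H).

Definition finitely_generated (G : groupType) : Prop :=
  exists s : seq G,
    forall H : set G, subgroup H -> (forall x, x \in s -> H x) -> H = setT.

Definition cyclic_group (G : groupType) : Prop :=
  exists x : G, forall y : G, exists n : nat, y = x ^+ n \/ y = x ^- n.

Definition isomorphic (G H : groupType) : Prop :=
  exists f : {multiplicative G -> H}, bijective f.

Definition infinite_index (G : groupType) (H : set G) : Prop :=
  infinite_set [set [set g * h | h in H] | g in [set: G]].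

Section DirectProduct.
Variables (I : Type) (F : I -> groupType).

Definition group_product : Type := forall i, F i.

HB.instance Definition _ := gen_eqMixin group_product.
HB.instance Definition _ := gen_choiceMixin group_product.

Let one : group_product := fun=> 1.
Let inv (x : group_product) : group_product := fun i => (x i)^-1.
Let mul (x y : group_product) : group_product := fun i => x i * y i.

Let mulA : associative mul.
Proof. by move=> x y z; apply: functional_extensionality_dep => i; apply: mulgA. Qed.
Let mul1 : left_id one mul.
Proof. by move=> x; apply: functional_extensionality_dep => i; apply: mul1g. Qed.
Let mulr1 : right_id one mul.
Proof. by move=> x; apply: functional_extensionality_dep => i; apply: mulg1. Qed.
Let mulV : left_inverse one inv mul.
Proof. by move=> x; apply: functional_extensionality_dep => i; apply: mulVg. Qed.
Let mulrV : right_inverse one inv mul.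
Proof. by move=> x; apply: functional_extensionality_dep => i; apply: mulgV. Qed.

HB.instance Definition _ :=
  isGroup.Build group_product mulA mul1 mulr1 mulV mulrV.

End DirectProduct.

Definition alternating_separable (G : groupType) (H : set G) : Prop :=
  forall s : seq G, (forall x, x \in s -> ~ H x) ->
  exists (n : nat) (f : {multiplicative G -> {perm 'I_n}}),
    range f = [set p | p \in 'Alt_('I_n)] /\
    forall x, x \in s -> ~ (f @` H) (f x).

(* The vertex set may be infinite. *)
Record sgraph := SGraph {
  vertex :> choiceType;
  adj : rel vertex;
  adj_sym : symmetric adj;
  adj_irr : irreflexive adj }.

Section Raag.
Variable Gr : sgraph.

(* The letter (v, true) stands for g_v and (v, false) for its inverse. *)
Definition word := seq (Gr * bool).

Inductive word_equiv : word -> word -> Prop :=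
| word_equiv_refl w : word_equiv w w
| word_equiv_sym w1 w2 : word_equiv w1 w2 -> word_equiv w2 w1
| word_equiv_trans w1 w2 w3 :
    word_equiv w1 w2 -> word_equiv w2 w3 -> word_equiv w1 w3
| word_equiv_cancel (w1 w2 : word) (v : Gr) (b : bool) :
    word_equiv (w1 ++ [:: (v, b); (v, ~~ b)] ++ w2) (w1 ++ w2)
| word_equiv_comm (w1 w2 : word) (u v : Gr) : adj u v ->
    word_equiv (w1 ++ [:: (u, true); (v, true)] ++ w2)
               (w1 ++ [:: (v, true); (u, true)] ++ w2).

Definition word_eq (w1 w2 : word) : bool := `[< word_equiv w1 w2 >].

Lemma word_eq_refl : reflexive word_eq.
Proof. by move=> w; apply/asboolP; apply: word_equiv_refl. Qed.
Lemma word_eq_sym : symmetric word_eq.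
Proof. by move=> w1 w2; apply/asboolP/asboolP; apply: word_equiv_sym. Qed.
Lemma word_eq_trans : transitive word_eq.
Proof.
move=> w2 w1 w3 /asboolP e12 /asboolP e23; apply/asboolP.
exact: word_equiv_trans e12 e23.
Qed.

Canonical word_equiv_rel := EquivRel word_eq word_eq_refl word_eq_sym word_eq_trans.

Definition raag : Type := {eq_quot word_equiv_rel}.

HB.instance Definition _ := Choice.on raag.
HB.instance Definition _ := EqQuotient.on raag.

Definition word_inv (w : word) : word := rev [seq (l.1, ~~ l.2) | l <- w].

Definition raag_one : raag := \pi_raag [::].
Definition raag_mul (x y : raag) : raag := \pi_raag (repr x ++ repr y).
Definition raag_inv (x : raag) : raag := \pi_raag (word_inv (repr x)).

Lemma raag_piP (w1 w2 : word) :
  \pi_raag w1 = \pi_raag w2 <-> word_equiv w1 w2.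
Proof.
split=> [/eqP|e]; first by rewrite eqmodE => /asboolP.
by apply/eqP; rewrite eqmodE; apply/asboolP.
Qed.

Lemma word_equiv_repr (w : word) : word_equiv (repr (\pi_raag w)) w.
Proof. by apply/raag_piP; rewrite reprK. Qed.

Lemma word_equiv_catl (w w1 w2 : word) :
  word_equiv w1 w2 -> word_equiv (w ++ w1) (w ++ w2).
Proof.
elim=> [w'|w1' w2' _|w1' w2' w3' _ IH1 _|w1' w2' v b|w1' w2' u v uv].
- exact: word_equiv_refl.
- exact: word_equiv_sym.
- exact: word_equiv_trans.
- by rewrite !(catA w); apply: word_equiv_cancel.
- by rewrite !(catA w); apply: word_equiv_comm.
Qed.

Lemma word_equiv_catr (w w1 w2 : word) :
  word_equiv w1 w2 -> word_equiv (w1 ++ w) (w2 ++ w).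
Proof.
elim=> [w'|w1' w2' _|w1' w2' w3' _ IH1 _|w1' w2' v b|w1' w2' u v uv].
- exact: word_equiv_refl.
- exact: word_equiv_sym.
- exact: word_equiv_trans.
- by rewrite -!catA; apply: word_equiv_cancel.
- by rewrite -!catA; apply: word_equiv_comm.
Qed.

Lemma word_equiv_cat (w1 w2 w3 w4 : word) :
  word_equiv w1 w2 -> word_equiv w3 w4 -> word_equiv (w1 ++ w3) (w2 ++ w4).
Proof.
move=> e12 e34.
exact: word_equiv_trans (word_equiv_catr _ e12) (word_equiv_catl _ e34).
Qed.

Lemma word_equiv_mulV (w : word) : word_equiv (w ++ word_inv w) [::].
Proof.
elim: w => [|[v b] w IHw]; first exact: word_equiv_refl.
rewrite /word_inv map_cons rev_cons -cats1 -/(word_inv w) /=.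
apply: (@word_equiv_trans _ ([:: (v, b)] ++ [::] ++ [:: (v, ~~ b)])).
  rewrite catA; apply: (@word_equiv_catl [:: (v, b)]).
  exact: word_equiv_catr IHw.
exact: (@word_equiv_cancel [::] [::] v b).
Qed.

Lemma word_invK : involutive word_inv.
Proof.
move=> w; rewrite /word_inv map_rev revK -map_comp -[RHS]map_id.
by apply: eq_map => -[v b] /=; rewrite negbK.
Qed.

Lemma raag_mulA : associative raag_mul.
Proof.
move=> x y z; apply/raag_piP.
apply: (@word_equiv_trans _ (repr x ++ repr y ++ repr z)).
  exact: word_equiv_catl (word_equiv_repr _).
rewrite catA; apply: word_equiv_catr.
exact/word_equiv_sym/word_equiv_repr.
Qed.

Lemma raag_mul1 : left_id raag_one raag_mul.
Proof.
move=> x; rewrite -[RHS]reprK; apply/raag_piP.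
exact: word_equiv_catr (word_equiv_repr [::]).
Qed.

Lemma raag_mulr1 : right_id raag_one raag_mul.
Proof.
move=> x; rewrite -[RHS]reprK; apply/raag_piP.
rewrite -[X in word_equiv _ X]cats0.
exact: word_equiv_catl (word_equiv_repr [::]).
Qed.

Lemma raag_mulrV : right_inverse raag_one raag_inv raag_mul.
Proof.
move=> x; apply/raag_piP.
apply: word_equiv_trans (word_equiv_mulV (repr x)).
exact: word_equiv_catl (word_equiv_repr _).
Qed.

Lemma raag_mulV : left_inverse raag_one raag_inv raag_mul.
Proof.
move=> x; apply/raag_piP.
apply: word_equiv_trans (word_equiv_mulV (word_inv (repr x))).
by rewrite word_invK; apply: word_equiv_catr (word_equiv_repr _).
Qed.

HB.instance Definition _ :=
  isGroup.Build raag raag_mulA raag_mul1 raag_mulr1 raag_mulV raag_mulrV.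

Definition raag_gen (v : Gr) : raag := \pi_raag [:: (v, true)].

End Raag.

Section Salvetti.
Variable Gr : sgraph.
Local Notation A := (raag Gr).

(* Since there is exactly one cube for each such vertex set, cubes of the
   Salvetti complex are represented by their vertex sets. *)
Definition cube_vertices (n : nat) (g : A) (us : n.-tuple Gr) : set A :=
  [set g * \prod_(j in P) raag_gen (tnth us j) | P in [set: {set 'I_n}]].

Definition salvetti_cube (n : nat) : set (set A) :=
  [set C | exists (g : A) (us : n.-tuple Gr),
     [/\ uniq us,
         {in us &, forall u v, commute (raag_gen u) (raag_gen v)} &
         C = cube_vertices g us]].

(* The faces of a cube are the cubes whose vertices are among its vertices. *)
Definition subcomplex (Y : set (set A)) : Prop :=
  (forall C, Y C -> exists n, salvetti_cube n C) /\
  (forall n C C', Y C -> salvetti_cube n C' -> C' `<=` C -> Y C').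

(* A path in the 1-skeleton is given by its first vertex x and the sequence p
   of the following ones. *)
Definition edge_path (x : A) (p : seq A) : Prop :=
  path (fun y z => `[< salvetti_cube 1 [set y; z] >]) x p.

Definition geodesic (x : A) (p : seq A) : Prop :=
  edge_path x p /\
  forall q, edge_path x q -> last x q = last x p -> (size p <= size q)%N.

Definition convex (Y : set (set A)) : Prop :=
  forall (x : A) (p : seq A), geodesic x p ->
    Y [set x] -> Y [set last x p] ->
    (forall y, y \in x :: p -> Y [set y]) /\
    path (fun y z => `[< Y [set y; z] >]) x p.

Definition translate (k : A) (C : set A) : set A := [set k * x | x in C].

Definition invariant_under (K : set A) (Y : set (set A)) : Prop :=
  forall k C, K k -> Y C -> Y (translate k C).

(* Y / K is compact if and only if it has finitely many cells, that is, K has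
   finitely many orbits of cubes in Y. *)
Definition acts_cocompactly (K : set A) (Y : set (set A)) : Prop :=
  finite_set [set [set translate k C | k in K] | C in Y].

Definition convex_cocompact (K : set A) : Prop :=
  exists Y : set (set A),
    [/\ Y !=set0, subcomplex Y, convex Y, invariant_under K Y &
        acts_cocompactly K Y].

End Salvetti.

(* Main.v *)
From HB Require Import structures.
From mathcomp Require Import all_boot all_fingroup alt zify.
From mathcomp Require Import generic_quotient boolp functions cardinality.
Require Import Defs.
From mathcomp Require Import fintype monoid classical_sets.

Set Implicit Arguments.
Unset Strict Implicit.
Unset Printing Implicit Defensive.

(** A finitely generated right-angled Artin group A is the product of the groups
of the connected components of the complement of its graph, and the components
with a single vertex give cyclic groups.

Let the complement be connected with at least two vertices, and let H act
cocompactly on a convex subcomplex with vertex set S. The generators act on the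
finite set of cosets Hg, g in S, by partial injections, and closing up their
segments to cycles gives commuting permutations for adjacent generators, by
convexity of S. The edges coming from the translation in H\A are called good.
Given a generator v and a set C of ends of good v-segments invariant under the
generators adjacent to v, one can insert a copy of C after C into the cycles of
v, where the generators adjacent to v act on the copy as on C and all others
trivially. Good edges are preserved. In this way the path of any given word
becomes good, so that finitely many elements outside H are separated from H.
Since H has infinite index, a bad edge remains, and inserting copies of copies
along a path through all vertices of the complement yields a point y on which
all generators but one, b, act trivially.

Take a not adjacent to b and two disjoint copies of this finite set, so that all
permutations become even. Join the two copies of y by a long cycle c for a through
new points, and attach at a new point of c a long cycle d for b through further new
points. The length of c and d is congruent to 1 modulo the orders of all previous
permutations, so c and d are powers of the actions of a and b. Their commutators
are 3-cycles which connect all points of c and d, that is, more than half of all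
points, and therefore transitivity forces the image to be the alternating group. *)

Local Open Scope group_scope.

(** * 3-cycles and alternating groups *)

Section ThreeCycles.
Variables (T : finType) (G : {group {perm T}}).
Implicit Types (x y z w m : T) (s : {perm T}).

(** Permutations compose from left to right, so for distinct points this is the cycle x -> y -> z ->
    x; for [y = z] it is the identity. *)
Definition cyc3 x y z : {perm T} := tperm x y * tperm x z.

Lemma cyc3J x y z s : cyc3 x y z ^ s = cyc3 (s x) (s y) (s z).
Proof. by rewrite conjMg !tpermJ. Qed.

Lemma cyc3V x y z : (cyc3 x y z)^-1 = cyc3 x z y.
Proof. by rewrite invMg !tpermV. Qed.

Definition has_cyc3 x y z := [&& x != y, x != z, y != z & cyc3 x y z \in G].

Lemma has_cyc3_swap x y z : has_cyc3 x y z -> has_cyc3 x z y.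
Proof.
case/and4P=> xy xz yz Gc; rewrite /has_cyc3 xz xy eq_sym yz /=.
by rewrite -cyc3V groupV.
Qed.

Lemma has_cyc3_rot x y z : has_cyc3 x y z -> has_cyc3 y z x.
Proof.
case/and4P=> xy xz yz Gc; rewrite /has_cyc3 yz !(eq_sym _ x) xy xz /=.
suff -> : cyc3 y z x = cyc3 x y z by [].
rewrite /cyc3 (tpermC y x) conjgC tpermJ tpermR tpermD // eq_sym.
Qed.

Lemma has_cyc3J x y z s : s \in G -> has_cyc3 x y z -> has_cyc3 (s x) (s y) (s z).
Proof.
move=> Gs /and4P[xy xz yz Gc]; rewrite /has_cyc3 !(inj_eq perm_inj) xy xz yz /=.
by rewrite -cyc3J groupJ.
Qed.

Lemma cyc3E x y z : x != y -> x != z -> y != z ->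
  (cyc3 x y z x = y) * (cyc3 x y z y = z) * (cyc3 x y z z = x).
Proof.
move=> xy xz yz; rewrite /cyc3 !permM !(tpermL, tpermR) (@tpermD _ x y z xz yz).
by rewrite tpermR tpermD // eq_sym.
Qed.

Lemma cyc3D x y z w : x != w -> y != w -> z != w -> cyc3 x y z w = w.
Proof. by move=> *; rewrite permM !tpermD. Qed.

(** Conjugating the first 3-cycle by the second gives [cyc3 y w z], the inverse of the one
    sought. *)
Lemma has_cyc3_share2 x y z w : z != w ->
  has_cyc3 x y z -> has_cyc3 x y w -> has_cyc3 y z w.
Proof.
move=> zw Tz /and4P[xy xw yw Gc]; have /and4P[_ xz yz _] := Tz.
have := has_cyc3J Gc Tz; rewrite !cyc3E // cyc3D // 1?eq_sym //.
exact: has_cyc3_swap.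
Qed.

(* Conjugating one of two 3-cycles with a single common point by the other
   yields 3-cycles sharing two points. *)
Lemma has_cyc3_trans m x y z w :
  x != y -> has_cyc3 m x z -> has_cyc3 m y w -> has_cyc3 m x y.
Proof.
move=> xy Tx Ty; have [zy|zy] := eqVneq z y; first by rewrite -zy.
have [wx|wx] := eqVneq w x.
  by rewrite -wx; apply: has_cyc3_swap.
have [zw|zw] := eqVneq z w.
  rewrite -zw in Ty.
  exact: has_cyc3_share2 xy (has_cyc3_rot (has_cyc3_rot Tx))
                            (has_cyc3_rot (has_cyc3_rot Ty)).
have /and4P[mx mz xz _] := Tx.
have /and4P[my mw yw Gc] := Ty.
have := has_cyc3J Gc Tx; rewrite !cyc3E // !cyc3D // 1?eq_sym // => Tyxz.
have Tzxm := has_cyc3_swap (has_cyc3_rot (has_cyc3_rot Tx)).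
have Tzxy := has_cyc3_swap (has_cyc3_rot (has_cyc3_rot Tyxz)).
have Txmy := has_cyc3_share2 my Tzxm Tzxy.
exact: has_cyc3_rot (has_cyc3_rot (has_cyc3_swap Txmy)).
Qed.

(** With the diagonal added this is an equivalence relation, transitive by [has_cyc3_trans], and G
    permutes its classes by [cyc3_relJ]. *)
Definition cyc3_rel x y := (x == y) || [exists z, has_cyc3 x y z].

Lemma cyc3_relP x y : x != y -> reflect (exists z, has_cyc3 x y z) (cyc3_rel x y).
Proof. by move=> /negPf xy; rewrite /cyc3_rel xy; apply: existsP. Qed.

Lemma cyc3_rel_has m x y : x != y -> m != x -> m != y ->
  cyc3_rel m x -> cyc3_rel m y -> has_cyc3 m x y.
Proof.
move=> xy mx my /(cyc3_relP mx)[z Tx] /(cyc3_relP my)[w Ty].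
exact: has_cyc3_trans xy Tx Ty.
Qed.

Lemma cyc3_rel_sym : symmetric cyc3_rel.
Proof.
suff imp x y : cyc3_rel x y -> cyc3_rel y x by move=> x y; apply/idP/idP; apply: imp.
have [->|xy] := eqVneq x y; first by rewrite /cyc3_rel eqxx.
case/(cyc3_relP xy)=> z Tz; rewrite eq_sym in xy; apply/(cyc3_relP xy).
by exists z; apply/has_cyc3_rot/has_cyc3_rot/has_cyc3_swap.
Qed.

Lemma cyc3_rel_trans : transitive cyc3_rel.
Proof.
move=> y x z xy yz.
have [->//|neq_xy] := eqVneq x y; have [<-//|neq_yz] := eqVneq y z.
have [->|neq_xz] := eqVneq x z; first by rewrite /cyc3_rel eqxx.
rewrite cyc3_rel_sym in xy; rewrite eq_sym in neq_xy.
have Tyxz := cyc3_rel_has neq_xz neq_xy neq_yz xy yz.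
by apply/(cyc3_relP neq_xz); exists y; apply: has_cyc3_rot.
Qed.

Lemma cyc3_relJ x y s : s \in G -> cyc3_rel x y -> cyc3_rel (s x) (s y).
Proof.
move=> Gs; have [->|xy] := eqVneq x y; first by rewrite /cyc3_rel !eqxx.
case/(cyc3_relP xy)=> z Tz.
have sxy : s x != s y by rewrite (inj_eq perm_inj).
by apply/(cyc3_relP sxy); exists (s z); apply: has_cyc3J.
Qed.

(** An even permutation is a product of pairs of transpositions. A pair with a common point is a
    3-cycle or trivial; otherwise inserting [tperm x z] twice splits it into two such pairs. *)
Lemma Alt_sub_cyc3 : (forall x y, cyc3_rel x y) -> 'Alt_T \subset G.
Proof.
move=> allR.
have G3 x y z : x != y -> x != z -> y != z -> tperm x y * tperm x z \in G.
  by move=> xy xz yz; have /and4P[] := cyc3_rel_has yz xy xz (allR x y) (allR x z).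
have G22 x y z w : x != y -> z != w -> tperm x y * tperm z w \in G.
  have share a b c : a != b -> a != c -> tperm a b * tperm a c \in G.
    by move=> ab ac; have [->|] := eqVneq b c; [rewrite tperm2 group1 | apply: G3].
  move=> xy zw; have [e|xz] := eqVneq x z; first by rewrite -e in zw *; apply: share.
  have -> : tperm x y * tperm z w = (tperm x y * tperm x z) * (tperm z x * tperm z w).
    by rewrite mulgA (tpermC z x) -(mulgA (tperm x y)) tperm2 mulg1.
  by rewrite groupM ?share // eq_sym.
apply/fintype.subsetP=> s; rewrite Alt_even; have [ts -> dts] := prod_tpermP s.
rewrite (odd_perm_prod dts); have [k] := ubnP (size ts).
elim: k ts dts => // k IHk [_ _ _|t [|u ts]] //=; first by rewrite big_nil group1.
rewrite negbK !big_cons mulgA => /and3P[dt du dts] lek ev; rewrite groupM ?G22 //.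
by apply: IHk => //; exact: ltnW lek.
Qed.

(* Applied to all pairs of powers of two long cycles with the single common
   point m, this yields all 3-cycles (m, x, y) with x, y on the two cycles. *)
Lemma commg_cyc3 (c d : {perm T}) m :
    (forall x, x != m -> c x = x \/ d x = x) -> c m != m -> d m != m ->
  [~ c, d] = cyc3 m (d m) (c m).
Proof.
move=> cd cm dm.
have dcm : d (c m) = c m.
  by case: (cd (c m)) => // /perm_inj /eqP; rewrite (negPf cm).
have cdm : c (d m) = d m.
  by case: (cd (d m)) => // /perm_inj /eqP; rewrite (negPf dm).
have m_dm : m != d m by rewrite eq_sym.
have m_cm : m != c m by rewrite eq_sym.
have dm_cm : d m != c m.
  by apply: contra dm => /eqP e; rewrite -(inj_eq (@perm_inj _ c)) cdm e.
apply/permP=> x; rewrite commgEl conjgE 3!permM.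
have fixV (s : {perm T}) z : s z = z -> s^-1 z = z by move=> e; rewrite -{1}e permK.
have [->|xm] := eqVneq x m.
  rewrite (cyc3E m_dm m_cm dm_cm).
  have cVm : c^-1 m != m by rewrite -(inj_eq (@perm_inj _ c)) permKV.
  have dcVm : d (c^-1 m) = c^-1 m.
    by case: (cd _ cVm) => //; rewrite permKV => e; rewrite -e eqxx in cVm.
  by rewrite (fixV _ _ dcVm) permKV.
have [->|xdm] := eqVneq x (d m).
  by rewrite (cyc3E m_dm m_cm dm_cm) (fixV _ _ cdm) permK dcm.
have [->|xcm] := eqVneq x (c m).
  rewrite (cyc3E m_dm m_cm dm_cm) permK.
  have dVm : d^-1 m != m by rewrite -(inj_eq (@perm_inj _ d)) permKV.
  have cdVm : c (d^-1 m) = d^-1 m.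
    by case: (cd _ dVm) => //; rewrite permKV => e; rewrite -e eqxx in dVm.
  by rewrite cdVm permKV.
rewrite cyc3D 1?eq_sym //.
have [cx|cx] := eqVneq (c x) x.
  rewrite (fixV _ _ cx); have [dx|dx] := eqVneq (d x) x.
    by rewrite (fixV _ _ dx) cx dx.
  have dVx : d^-1 x != m by rewrite -(inj_eq (@perm_inj _ d)) permKV.
  have [->|] := cd _ dVx; first by rewrite permKV.
  by rewrite permKV => e; rewrite {1}e permKV eqxx in dx.
have dx : d x = x by case: (cd _ xm) => // e; rewrite e eqxx in cx.
have cVx : c^-1 x != m by rewrite -(inj_eq (@perm_inj _ c)) permKV.
have [|/fixV ->] := cd _ cVx; last by rewrite permKV dx.
by rewrite permKV => e; rewrite {1}e permKV eqxx in cx.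
Qed.

(** All points moved by c or d are in the class of m for [cyc3_rel], which therefore contains more
    than half of T. The class of [s m] is at least as large, so the two meet and coincide; by
    transitivity there is only one class. *)
Lemma Alt_sub_of_two_cycles (c d : {perm T}) m :
    c \in G -> d \in G -> c m != m -> d m != m ->
    (forall x, [|| x == m, c x == x | d x == x]) ->
    (forall x, c x != x -> exists i, x = (c ^+ i) m) ->
    (forall x, d x != x -> exists i, x = (d ^+ i) m) ->
    (forall x y, exists2 s, s \in G & s x = y) ->
    #|T| < 2 * #|[pred x | (c x != x) || (d x != x)]| ->
  'Alt_T \subset G.
Proof.
move=> Gc Gd cm dm cd orb_c orb_d transG big.
have cdP i j x : x != m -> (c ^+ i) x = x \/ (d ^+ j) x = x.
  by move=> /negPf xm; case/or3P: (cd x) => [|/eqP e|/eqP e];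
    rewrite ?xm //; [left | right]; apply: permX_fix.
have T3 x y : c x != x -> x != m -> d y != y -> y != m -> has_cyc3 m y x.
  move=> /orb_c[i ->] cim /orb_d[j ->] djm.
  have ij := cdP i j; have E := commg_cyc3 ij cim djm.
  rewrite /has_cyc3 -E groupR ?groupX // andbT !(eq_sym m) cim djm /=.
  apply/eqP=> e; case: (ij _ cim) => [/perm_inj|].
    by move/eqP; rewrite (negPf cim).
  by rewrite -e => /perm_inj /eqP; rewrite (negPf djm).
have c2m : c (c m) != c m by rewrite (inj_eq perm_inj).
have d2m : d (d m) != d m by rewrite (inj_eq perm_inj).
have Rm x : (c x != x) || (d x != x) -> cyc3_rel m x.
  have [->|xm] := eqVneq x m; first by rewrite /cyc3_rel eqxx.
  rewrite eq_sym in xm => /orP[cx|dx]; apply/(cyc3_relP xm).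
    by exists (d m); apply: has_cyc3_swap; apply: T3; rewrite // eq_sym.
  by exists (c m); apply: T3; rewrite // eq_sym.
have Rall y : cyc3_rel m y.
  have [s Gs <-] := transG m y.
  pose P := [pred x | cyc3_rel m x].
  pose Q := [pred x | cyc3_rel (s m) x].
  have PQ : #|P| <= #|Q|.
    rewrite -(card_image (@perm_inj _ s) P); apply/subset_leq_card/fintype.subsetP=> z.
    by case/mapP=> x; rewrite mem_enum => mx ->; rewrite inE; apply: cyc3_relJ.
  have bigP : #|T| < 2 * #|P|.
    apply: leq_trans big _; rewrite leq_mul2l; apply: subset_leq_card.
    by apply/fintype.subsetP=> x; apply: Rm.
  have : 0 < #|[predI P & Q]|.
    rewrite -(ltn_add2l #|[predU P & Q]|) addn0 cardUI.
    apply: leq_ltn_trans (max_card _) _; apply: leq_trans bigP _.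
    by rewrite mul2n -addnn leq_add2l.
  case/card_gt0P=> x /andP[Px Qx]; apply: cyc3_rel_trans Px _.
  by rewrite cyc3_rel_sym.
apply: Alt_sub_cyc3 => x y; apply: cyc3_rel_trans (Rall y).
by rewrite cyc3_rel_sym.
Qed.

End ThreeCycles.

(** * Long cycles, parity and transitivity *)

Lemma cycle_perm (T : finType) (l : seq T) : uniq l -> 1 < size l ->
  exists c : {perm T},
    [/\ forall x, (c x != x) = (x \in l),
        forall x y, x \in l -> y \in l -> exists i, y = (c ^+ i) x &
        c ^+ size l = 1].
Proof.
move=> Ul l_gt1; pose c := perm (can_inj (prev_next Ul)).
have cE x : c x = next l x by rewrite permE.
have iterE i x : (c ^+ i) x = iter i (next l) x.
  by rewrite permX; apply: eq_iter.
have lc : fcycle (next l) l by apply: cycle_next.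
have ordl x : x \in l -> fingraph.order (next l) x = size l.
  by exact: order_cycle lc Ul x.
have out x : x \notin l -> c x = x.
  by move=> lx; rewrite cE next_nth (negPf lx).
exists c; split=> [x|x y lx ly|].
- apply/idP/idP=> [|lx]; first by apply: contraR => /out->.
  apply/eqP=> cx; have := ordl x lx; suff: fingraph.order (next l) x <= 1 by lia.
  rewrite /fingraph.order -(card1 x); apply: subset_leq_card.
  apply/fintype.subsetP=> z /=; rewrite inE /= => /iter_findex <-.
  by elim: (findex _ _ _) => [|n /eqP] /=; rewrite inE // => ->; rewrite -cE cx.
- exists (findex (next l) x y); rewrite iterE iter_findex //.
  by rewrite (fconnect_cycle lc lx).
- apply/permP=> x; rewrite perm1; have [lx|/out cx] := boolP (x \in l).
    by rewrite iterE -(ordl x lx) iter_order //; apply: can_inj (prev_next Ul).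
  by apply: permX_fix.
Qed.

Lemma odd_order_even (T : finType) (c : {perm T}) n :
  odd n -> c ^+ n = 1 -> odd_perm c = false.
Proof.
move=> on cn; have : odd_perm (c ^+ n) = odd_perm c.
  rewrite -(odd_double_half n) on /= add1n expgS odd_permM -addnn expgD odd_permM.
  by rewrite addbb addbF.
by rewrite cn odd_perm1.
Qed.

(** Transpositions generate, so parity need only be known on their images: [k = true] means that f
    preserves parity, [k = false] that all images are even. *)
Lemma odd_perm_morph (T T' : finType) (f : {perm T} -> {perm T'}) k :
    f 1 = 1 -> {morph f : s t / s * t} ->
    (forall x y, x != y -> odd_perm (f (tperm x y)) = k) ->
  forall s, odd_perm (f s) = k && odd_perm s.
Proof.
move=> f1 fM ft s; have [ts -> dts] := prod_tpermP s; elim: ts dts => [_|t ts IH] /=.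
  by rewrite big_nil f1 !odd_perm1 andbF.
case/andP=> dt dts; rewrite big_cons fM !odd_permM ft // IH // odd_tperm [t.1 != t.2]dt.
by case: (k).
Qed.

Section PermRename.
Variables (T T' : finType) (f : T -> T') (g : T' -> T).
Hypotheses (fK : cancel f g) (gK : cancel g f).

Fact perm_rename_subproof (s : {perm T}) : injective (fun i => f (s (g i))).
Proof. by move=> i j /(can_inj fK)/perm_inj/(can_inj gK). Qed.
Definition perm_rename s := perm (@perm_rename_subproof s).

Lemma perm_renameE s x : perm_rename s (f x) = f (s x).
Proof. by rewrite permE fK. Qed.

Lemma perm_renameM : {morph perm_rename : s t / s * t}.
Proof. move=> s t; apply/permP=> i; rewrite permM -(gK i) !perm_renameE permM; by []. Qed.

Lemma perm_rename_odd s : odd_perm (perm_rename s) = odd_perm s.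
Proof.
rewrite (odd_perm_morph (k := true)) //; last 1 first.
- move=> x y xy; suff -> : perm_rename (tperm x y) = tperm (f x) (f y).
    by rewrite odd_tperm (inj_eq (can_inj fK)).
  apply/permP=> i; rewrite -(gK i) perm_renameE inj_tperm //; exact: can_inj fK.
- by apply/permP=> i; rewrite -(gK i) perm_renameE !perm1.
- exact: perm_renameM.
Qed.

End PermRename.

Section Double.
Variables (X N : finType).
Local Notation T := (X * bool + N)%type.

(** The second copy of X makes every permutation even; the fixed points N are room for the long
    cycles. *)
Definition double_fun (s : {perm X}) (z : T) : T :=
  match z with inl (x, i) => inl (s x, i) | inr n => inr n end.
Fact double_inj s : injective (double_fun s).
Proof. by case=> [[x i]|n] [[y j]|m] //= [] /perm_inj-> ->. Qed.
Definition double_perm s := perm (@double_inj s).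

Lemma double_permM : {morph double_perm : s t / s * t}.
Proof. by move=> s t; apply/permP=> -[[x i]|n]; rewrite permM !permE /= ?permM. Qed.

Lemma double_perm1 : double_perm 1 = 1.
Proof. by apply/permP=> -[[x i]|n]; rewrite permE /= !perm1. Qed.

Lemma double_perm_even s : odd_perm (double_perm s) = false.
Proof.
apply: (odd_perm_morph (k := false) double_perm1 double_permM _ s) => x y xy.
have injl i : injective (fun x : X => inl (x, i) : T) by move=> ? ? [].
suff -> : double_perm (tperm x y) =
    tperm (inl (x, true)) (inl (y, true)) * tperm (inl (x, false)) (inl (y, false)).
  by rewrite odd_permM !odd_tperm !(inj_eq (injl _)) addbb.
have E z i : tperm (inl (x, i)) (inl (y, i)) (inl (z, i)) = inl (tperm x y z, i) :> T.
  exact/esym/(inj_tperm _ _ _ (injl i)).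
apply/permP=> -[[z []]|n]; rewrite permE permM /=.
- by rewrite E [RHS]tpermD //; apply/eqP=> -[].
- by rewrite [tperm _ _ (inl (z, false))]tpermD ?E //; apply/eqP=> -[].
- by rewrite !tpermD.
Qed.

End Double.

(** Transitivity without mention of the generated group: an invariant predicate is constant. This
    form is easy to carry over to larger sets. *)
Definition transitive_family (V : Type) (X : finType) (act : V -> {perm X}) :=
  forall P : pred X, (forall v x, P (act v x) = P x) -> forall x y, P x = P y.

Lemma transitive_family_group (V : Type) (X : finType) (act : V -> {perm X})
    (G : {group {perm X}}) :
  transitive_family act -> (forall v, act v \in G) ->
  forall x y, exists2 s, s \in G & s x = y.
Proof.
move=> tr Gact x y.
have inv v z : [exists s in G, s x == act v z] = [exists s in G, s x == z].
  apply/exists_inP/exists_inP=> -[s Gs /eqP e].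
    by exists (s * (act v)^-1); rewrite ?groupM ?groupV // permM e permK.
  by exists (s * act v); rewrite ?groupM // permM e.
have := tr (fun z => [exists s in G, s x == z]) inv y x.
have -> : [exists s in G, s x == x].
  by apply/exists_inP; exists 1; rewrite ?group1 // perm1.
by case/exists_inP=> s Gs /eqP; exists s.
Qed.

Lemma commute_perm_fix (T : finType) (s t : {perm T}) :
  (forall x, t x != x -> s x = x) -> commute s t.
Proof.
move=> st; apply/permP=> x; rewrite !permM.
have [tx|tx] := eqVneq (t x) x.
  rewrite tx; have [//|tsx] := eqVneq (t (s x)) (s x).
  by have /perm_inj e := st _ tsx; rewrite e tx eqxx in tsx.
by rewrite st // st // (inj_eq perm_inj).
Qed.

(** * Attaching two long cycles *)

Section TwoCycles.
Variables (V : eqType) (adj : rel V) (X : finType) (act : V -> {perm X}).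
Variables (good : V -> pred X) (y : X) (a b : V).
Hypotheses (adjC : symmetric adj) (act_comm : forall u v, adj u v -> commute (act u) (act v)).
Hypotheses (act_trans : transitive_family act) (neq_ab : a != b) (nadj : ~~ adj a b).
Hypotheses (fix_y : forall v, v != b -> act v y = y) (bad_y : ~~ good a y).

Lemma alternating_extension :
  exists (T : finType) (tau : V -> {perm T}) (j : X -> T),
    [/\ injective j, forall u v, adj u v -> commute (tau u) (tau v),
        forall v, tau v \in 'Alt_T,
        forall v x, good v x -> tau v (j x) = j (act v x) &
        forall G : {group {perm T}}, (forall v, tau v \in G) -> 'Alt_T \subset G].
Proof.
(* [M] is a multiple of the order of every permutation of X. The value of [r] gives both cycles the
   length 2M + 1: c has two old points and r + 1 new ones, d has [m] and r + 2 new ones. Being odd,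
   this length makes c and d even permutations. *)
pose M := (#|X|)`!; pose r := (2 * M.-1)%N.
have M_gt0 : 0 < M by apply: fact_gt0.
pose T := (X * bool + ('I_r.+1 + 'I_r.+2))%type.
pose y1 : T := inl (y, true); pose y2 : T := inl (y, false).
pose m : T := inr (inl ord0).
pose lC : seq T := [:: y1; y2] ++ [seq inr (inl i) | i <- enum 'I_r.+1].
pose lD' : seq T := [seq inr (inr i) | i <- enum 'I_r.+2].
pose lD := m :: lD'.
have sC : size lC = (2 * M)%N.+1 by rewrite size_cat size_map size_enum_ord /=; lia.
have sD : size lD = (2 * M)%N.+1 by rewrite /= size_map size_enum_ord /=; lia.
have UC : uniq lC.
  rewrite cat_uniq map_inj_uniq ?enum_uniq ?andbT; last by move=> ? ? [].
  apply/andP; split; last by apply/hasPn=> z /mapP[i _ ->].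
  by rewrite /= inE andbT; apply/eqP=> -[].
have UD' : uniq lD' by rewrite map_inj_uniq ?enum_uniq // => ? ? [].
have UD : uniq lD by rewrite /= UD' andbT; apply/mapP=> -[].
have mC : m \in lC by rewrite mem_cat map_f ?orbT // mem_enum.
have [|c [csupp corb cp]] := cycle_perm UC; first by rewrite sC; lia.
have [|d [dsupp dorb dp]] := cycle_perm UD; first by rewrite sD; lia.
have cfix z : z \notin lC -> c z = z by rewrite -csupp negbK => /eqP.
have dfix z : z \notin lD -> d z = z by rewrite -dsupp negbK => /eqP.
have memCl x i : (inl (x, i) \in lC) = (x == y).
  rewrite mem_cat !inE; apply/orP/eqP=> [[/orP[]/eqP[]//|/mapP[]//]|->].
  by case: i; rewrite eqxx ?orbT; left.
have memDl x i : (inl (x, i) \in lD) = false.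
  by rewrite inE /=; apply/mapP=> -[].
pose D (s : {perm X}) : {perm T} := double_perm ('I_r.+1 + 'I_r.+2)%type s.
have Dl s x i : D s (inl (x, i)) = inl (s x, i) by rewrite permE.
have Dr s n : D s (inr n) = inr n by rewrite permE.
have DM := @double_permM X ('I_r.+1 + 'I_r.+2)%type.
pose e v : {perm T} := if v == a then c else if v == b then d else 1.
have ea : e a = c by rewrite /e eqxx.
have eb : e b = d by rewrite /e eq_sym (negPf neq_ab) eqxx.
(* The only old points on c are the copies of y, which all generators but b fix. *)
have Dc v : v != b -> commute (D (act v)) c.
  move=> vb; apply: commute_perm_fix => -[[x i]|n]; last by rewrite Dr.
  by rewrite csupp memCl Dl => /eqP->; rewrite fix_y.
have Dd v : commute (D (act v)) d.
  by apply: commute_perm_fix => -[[x i]|n]; rewrite ?Dr // dsupp memDl.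
have D_comm u v : adj u v -> commute (D (act u)) (D (act v)).
  by move=> /act_comm uv; rewrite /commute -!DM uv.
have D_ord s : D s ^+ (2 * M)%N = 1.
  have DX n : D s ^+ n = D (s ^+ n).
    elim: n => [|n IHn]; first exact/esym/double_perm1.
    by rewrite !expgS IHn; exact/esym/DM.
  rewrite mulnC expgM DX [s ^+ M](_ : _ = 1) ?[D 1]double_perm1 ?expg1n //.
  have /dvdnP[k ->] : #[s] %| M by rewrite /M -card_Sym; exact: cardSg (finset.subsetT _).
  by rewrite mulnC expgM expg_order expg1n.
pose tau v := D (act v) * e v.
exists T, tau, (fun x => inl (x, true)); split.
- by move=> x z [].
- move=> u v uv.
  have e_comm u' v' : adj u' v' -> commute (D (act u')) (e v').
    move=> uv'; rewrite /e; case: eqVneq => [v'a|_]; last first.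
      by case: eqVneq => _; [exact: Dd | exact: commute1].
    apply: Dc; apply: contraNneq nadj => u'b.
    by rewrite -v'a -u'b adjC.
  have ee : commute (e u) (e v).
    rewrite /e; case: (eqVneq u a) => [ua|_]; case: (eqVneq v a) => [va|_].
    + exact: commute_refl.
    + case: (eqVneq v b) => [vb|_]; last exact: commute1.
      by move: nadj; rewrite -ua -vb uv.
    + case: (eqVneq u b) => [ub|_]; last exact/commute_sym/commute1.
      by move: nadj; rewrite -ub -va adjC uv.
    + case: (eqVneq u b) => [ub|_]; last exact/commute_sym/commute1.
      by case: (eqVneq v b) => [vb|_]; [exact: commute_refl | exact: commute1].
  apply: commuteM; apply/commute_sym; apply: commuteM.
  + exact/commute_sym/D_comm.
  + by apply: e_comm; rewrite adjC.
  + exact/commute_sym/e_comm.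
  + exact/commute_sym.
- move=> v; rewrite Alt_even odd_permM [odd_perm _]double_perm_even addFb /e.
  case: ifP => _; first by rewrite (odd_order_even _ cp) // sC /= oddM.
  case: ifP => _; first by rewrite (odd_order_even _ dp) // sD /= oddM.
  by rewrite odd_perm1.
- move=> v x gv; rewrite permM Dl /e; case: eqVneq => [va|_].
    (* A good edge of a cannot end at y: as a fixes y, it would start there too, where a is bad. *)
    apply: cfix; rewrite memCl; apply: contra bad_y => /eqP e1.
    suff <- : x = y by rewrite -va.
    by apply: (@perm_inj _ (act v)); rewrite e1 fix_y // va.
  by case: ifP => _; rewrite ?perm1 // dfix // memDl.
- move=> G Gtau.
  (* The power with exponent 2M kills [D (act v)] and turns w into its inverse. *)
  have pow_e v w : commute (D (act v)) w -> w ^+ (2 * M)%N.+1 = 1 ->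
      D (act v) * w \in G -> w \in G.
    move=> cDw wp /(groupX (2 * M)%N); rewrite expgMn // D_ord mul1g => Gw.
    by rewrite -groupV -(mulg1 w^-1) -wp expgS mulKg.
  have Gc : c \in G.
    by apply: (@pow_e a); [exact: Dc | rewrite -sC | rewrite -ea; apply: Gtau].
  have Gd : d \in G.
    by apply: (@pow_e b); [exact: Dd | rewrite -sD | rewrite -eb; apply: Gtau].
  (* An invariant predicate is constant on each copy of X, on c and on d. The cycle c meets both
     copies, and d meets c in [m]. *)
  have tau_trans : transitive_family tau.
    move=> P Pinv.
    have Pcopy i x z : P (inl (x, i)) = P (inl (z, i)).
      apply: (act_trans (P := fun x => P (inl (x, i)))) => v {}x.
      rewrite -(Pinv v (inl (x, i))) permM Dl /e; case: eqVneq => [va|_].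
        have [ay|ay] := eqVneq (act v x) y; last by rewrite cfix // memCl.
        have xy : x = y by apply: (@perm_inj _ (act v)); rewrite ay fix_y // va.
        by rewrite ay -xy -[LHS](Pinv v) permM Dl ay /e va eqxx xy.
      by case: ifP => _; rewrite ?perm1 // dfix // memDl.
    have PC z : z \in lC -> P z = P y1.
      have Pc x : x \in lC -> P (c x) = P x.
        move=> lx; rewrite -(Pinv a x) permM ea; congr (P (c _)).
        case: x lx => [[x i]|n] lx; rewrite ?Dr //.
        by move: lx; rewrite memCl Dl => /eqP->; rewrite fix_y.
      move=> lz; have [|//|i ->] := corb y1 z; first by rewrite memCl.
      have cC k : (c ^+ k) y1 \in lC.
        elim: k => [|k IHk]; first by rewrite perm1 memCl.
        by rewrite expgSr permM -csupp (inj_eq perm_inj) csupp.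
      elim: i => [|i IHi]; first by rewrite perm1.
      by rewrite expgSr permM Pc.
    have PD z : z \in lD -> P z = P m.
      have Pd x : P (d x) = P x.
        have [lx|/dfix->//] := boolP (x \in lD).
        rewrite -(Pinv b x) permM eb; congr (P (d _)).
        by case: x lx => [[x i]|n]; rewrite ?memDl ?Dr.
      move=> lz; have [||i ->] := dorb m z; rewrite ?mem_head //.
      by elim: i => [|i IHi]; rewrite ?perm1 // expgSr permM Pd.
    have Pall z : P z = P y1.
      case: z => [[x i]|[i|i]].
      + rewrite (Pcopy i x y); apply: PC; first by rewrite memCl.
      + by apply: PC; rewrite mem_cat map_f ?orbT // mem_enum.
      + by rewrite PD ?PC // inE map_f ?orbT // mem_enum.
    by move=> x z; rewrite !Pall.
  apply: (Alt_sub_of_two_cycles (m := m) Gc Gd).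
  + by rewrite csupp.
  + by rewrite dsupp mem_head.
  + move=> -[[x i]|[i|i]].
    * by rewrite dfix ?eqxx ?orbT // memDl.
    * have [->|i0] := eqVneq i ord0; first by rewrite eqxx.
      rewrite dfix ?eqxx ?orbT // inE negb_or; apply/andP; split.
        by apply: contra i0 => /eqP[->].
      by apply/mapP=> -[].
    * rewrite cfix ?eqxx ?orbT // mem_cat; apply/orP=> -[]; first by [].
      by case/mapP.
  + by move=> x; rewrite csupp => lx; apply: corb.
  + by move=> x; rewrite dsupp => lx; apply: dorb; rewrite ?mem_head.
  + by move=> x z; apply: transitive_family_group tau_trans Gtau x z.
  (* The cycles move at least 4M + 1 points, while T has 2|X| + 4M - 1 points and |X| is at most
     M. *)
  have : size (lC ++ lD') <= #|[pred x | (c x != x) || (d x != x)]|.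
    rewrite -(card_uniqP _); last first.
      rewrite cat_uniq UC UD' andbT; apply/hasPn=> z /mapP[i _ ->].
      by rewrite mem_cat; apply/orP=> -[]//; case/mapP.
    apply: subset_leq_card; apply/fintype.subsetP=> z; rewrite mem_cat => lz.
    rewrite -topredE /= csupp dsupp [_ \in lD]in_cons.
    by case/orP: lz => ->; rewrite ?orbT.
  have : #|X| <= M by exact: fact_geq.
  rewrite size_cat sC size_map size_enum_ord !(card_sum, card_prod, card_bool, card_ord).
  rewrite /r; lia.
Qed.
End TwoCycles.

Local Open Scope classical_set_scope.
Local Open Scope quotient_scope.

(** * Morphisms of right-angled Artin groups *)

Lemma morph_multiplicative (G H : groupType) (f : G -> H) :
  {morph f : x y / x * y} -> exists F : {multiplicative G -> H}, F =1 f.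
Proof.
move=> fM; pose F : {multiplicative G -> H} := HB.pack f (isMultiplicative.Build G H f fM).
by exists F.
Qed.

Section Multiplicative.
Variables (G H : groupType) (f : {multiplicative G -> H}).

Lemma multiplicative1 : f 1 = 1.
Proof. by apply: (mulgI (f 1)); rewrite -gmulfM !mulg1. Qed.

Lemma multiplicativeV x : f x^-1 = (f x)^-1.
Proof. by apply: (mulgI (f x)); rewrite -gmulfM !mulgV multiplicative1. Qed.

End Multiplicative.

Section RaagMorphisms.
Variable Gr : sgraph.
Local Notation A := (raag Gr).
Local Notation gen := (@raag_gen Gr).

Definition word_val (w : word Gr) : A := \pi_A w.

Lemma word_valK (x : A) : word_val (repr x) = x.
Proof. exact: reprK. Qed.

Lemma word_val_cat (w1 w2 : word Gr) : word_val (w1 ++ w2) = word_val w1 * word_val w2.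
Proof. by apply/esym/raag_piP; apply: word_equiv_cat; apply: word_equiv_repr. Qed.

Definition letter_val (K : groupType) (k : Gr -> K) (l : Gr * bool) : K :=
  if l.2 then k l.1 else (k l.1)^-1.

Lemma word_val_letter l : word_val [:: l] = letter_val gen l.
Proof.
case: l => v [] //=; apply/(mulgI (gen v)); rewrite [RHS]mulgV.
rewrite [gen v](_ : _ = word_val [:: (v, true)]) // -word_val_cat.
exact/raag_piP/(@word_equiv_cancel Gr [::] [::] v true).
Qed.

Lemma word_val_cons l w : word_val (l :: w) = letter_val gen l * word_val w.
Proof. by rewrite -cat1s word_val_cat word_val_letter. Qed.

Lemma raag_ind (P : A -> Prop) :
  P 1 -> (forall x l, P x -> P (x * letter_val gen l)) -> forall x, P x.
Proof.
move=> P1 PM x; rewrite -(word_valK x); elim/last_ind: (repr x) => [|w l IHw] //.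
by rewrite -cats1 word_val_cat word_val_letter; apply: PM.
Qed.

Lemma gen_commute u v : adj u v -> commute (gen u) (gen v).
Proof.
move=> uv; rewrite /commute -[gen u]/(word_val [:: (u, true)]).
rewrite -[gen v]/(word_val [:: (v, true)]) -!word_val_cat.
exact/raag_piP/(@word_equiv_comm Gr [::] [::] u v uv).
Qed.

Section Lift.
Variables (K : groupType) (k : Gr -> K).
Hypothesis k_comm : forall u v, adj u v -> commute (k u) (k v).

Definition word_image (w : word Gr) : K := \prod_(l <- w) letter_val k l.

Lemma word_image_equiv w1 w2 : word_equiv w1 w2 -> word_image w1 = word_image w2.
Proof.
elim=> [|? ? _ ->|? ? ? _ -> _ ->|w w' v b|w w' u v uv] //; rewrite /word_image !big_cat /=.
  by rewrite !big_cons big_nil mulg1 /letter_val /=; case: b; rewrite (mulgV, mulVg) mul1g.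
by rewrite !big_cons !big_nil !mulg1 /letter_val /= k_comm.
Qed.

(** The universal property of the presentation: [word_image] respects the relations, so it may be
    evaluated on any representative. *)
Lemma raag_lift : exists f : {multiplicative A -> K}, forall v, f (gen v) = k v.
Proof.
pose f (x : A) := word_image (repr x).
have fE w : f (word_val w) = word_image w by exact/word_image_equiv/word_equiv_repr.
have fM : {morph f : x y / x * y} by move=> x y; rewrite fE /word_image big_cat.
have [F FE] := morph_multiplicative fM.
by exists F => v; rewrite FE fE /word_image big_seq1.
Qed.

End Lift.
End RaagMorphisms.

(** * Finite models of Schreier graphs *)

(** This is the translate [B g]. For a right coset [B = H k] it is the coset [H k g], the vertex of
    the Schreier graph that g leads to. *)
Definition rtrans (Gr : sgraph) (B : set (raag Gr)) (g : raag Gr) : set (raag Gr) :=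
  [set x | B (x * g^-1)].

Section RightTranslation.
Variable Gr : sgraph.
Implicit Types (B : set (raag Gr)) (g h : raag Gr).

Lemma rtransM B g h : rtrans B (g * h) = rtrans (rtrans B g) h.
Proof. by apply: funext => x; rewrite /rtrans /mkset invgM mulgA. Qed.

Lemma rtrans1 B : rtrans B 1 = B.
Proof. by apply: funext => x; rewrite /rtrans /mkset invg1 mulg1. Qed.

Lemma rtransK B g : rtrans (rtrans B g) g^-1 = B.
Proof. by rewrite -rtransM mulgV rtrans1. Qed.

Lemma rtransVK B g : rtrans (rtrans B g^-1) g = B.
Proof. by rewrite -rtransM mulVg rtrans1. Qed.

End RightTranslation.

(* A finite model of a part of the Schreier graph on the orbit of the right
   coset B: along good edges the action is the right translation of the labels,
   the bad edges only serve to complete partial injections to permutations. *)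
Record marked_action (Gr : sgraph) (B : set (raag Gr)) := MarkedAction {
  pt : finType;
  act : Gr -> {perm pt};
  good : Gr -> pred pt;
  lab : pt -> set (raag Gr);
  base : pt;
  act_comm : forall u v, adj u v -> commute (act u) (act v);
  good_act : forall u v x, adj u v -> good v (act u x) = good v x;
  lab_act : forall v x, good v x -> lab (act v x) = rtrans (lab x) (raag_gen v);
  lab_base : lab base = B;
  act_trans : transitive_family act }.

Section Walks.
Variables (Gr : sgraph) (B : set (raag Gr)).
Implicit Types M N L : marked_action B.

(** Only good edges are followed. An inverse letter runs an edge backwards, so goodness is tested at
    the other end [z], where the edge starts. *)
Definition step M (x : pt M) (l : Gr * bool) : option (pt M) :=
  let: (v, b) := l in
  if b then if good v x then Some (act M v x) else None
  else let z := (act M v)^-1 x in if good v z then Some z else None.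

Fixpoint walk M (x : pt M) (w : word Gr) : option (pt M) :=
  if w is l :: w' then if step x l is Some z then walk z w' else None else Some x.

Lemma lab_step M (x y : pt M) l :
  step x l = Some y -> lab y = rtrans (lab x) (letter_val (@raag_gen Gr) l).
Proof.
case: l => v [] /=; case: ifP => // g [<-]; first exact: lab_act.
by rewrite /letter_val /= -{2}(permKV (act M v) x) lab_act // rtransK.
Qed.

Lemma lab_walk M (x y : pt M) w :
  walk x w = Some y -> lab y = rtrans (lab x) (word_val w).
Proof.
elim: w x => [|l w IHw] x /=; first by move=> [->]; rewrite rtrans1.
case E: (step x l) => [z|] // /IHw ->.
by rewrite (lab_step E) -rtransM -word_val_cons.
Qed.

Lemma walk_cat M (x : pt M) w1 w2 :
  walk x (w1 ++ w2) = if walk x w1 is Some y then walk y w2 else None.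
Proof. by elim: w1 x => //= l w IHw x; case: (step x l). Qed.

(** Bad edges of M may be rerouted in N. Preserving the good ones suffices to carry walks over, by
    [walk_extends]. *)
Definition extends M N := exists j : pt M -> pt N,
  [/\ injective j, j (base M) = base N &
      forall v x, good v x -> good v (j x) /\ act N v (j x) = j (act M v x)].

Lemma extends_refl M : extends M M.
Proof. by exists id; split=> // x y. Qed.

Lemma extends_trans M N L : extends M N -> extends N L -> extends M L.
Proof.
move=> [j [jI jb jg]] [k [kI kb kg]]; exists (k \o j); split=> /=.
- exact: inj_comp.
- by rewrite jb.
- by move=> v x /jg[gj <-]; have [? <-] := kg v _ gj.
Qed.

Lemma walk_extends M N (j : pt M -> pt N) :
    (forall v x, good v x -> good v (j x) /\ act N v (j x) = j (act M v x)) ->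
  forall x y w, walk x w = Some y -> walk (j x) w = Some (j y).
Proof.
move=> jg x y w; elim: w x => [x [->]//|[v b] w IHw] x /=.
case: b; case: ifP => // g /IHw <-; first by have [-> ->] := jg v x g.
have [gj E] := jg v _ g; rewrite permKV in E.
by rewrite -E permK gj.
Qed.

End Walks.

Lemma adj_neq (Gr : sgraph) (u w : Gr) : adj u w -> u != w.
Proof. by apply: contraL => /eqP->; rewrite adj_irr. Qed.

(** * Insertion of copies *)

Section Insertion.
Variables (Gr : sgraph) (B : set (raag Gr)) (M : marked_action B).
Variables (v : Gr) (C : pred (pt M)) (e : bool).
Hypothesis C_bad : forall x, C x -> ~~ good v x.
Hypothesis C_link : forall u x, adj u v -> C (act M u x) = C x.

Local Notation sT := {x : pt M | C x}.
Local Notation T := (pt M + sT)%type.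

(** The v-edge that starts at a point x of C is subdivided by the copy of x. The default [c] of
    [insubd] is never taken, because of [C_link]. *)
Definition ins_fun (u : Gr) (z : T) : T :=
  if u == v then
    match z with
    | inl x => if insub x is Some c then inr c else inl (act M v x)
    | inr c => inl (act M v (val c))
    end
  else match z with
    | inl x => inl (act M u x)
    | inr c => inr (if adj u v then insubd c (act M u (val c)) else c)
    end.

Lemma val_ins u (c : sT) : adj u v -> val (insubd c (act M u (val c))) = act M u (val c).
Proof. by move=> uv; rewrite insubdK // -topredE /= C_link //; exact: (valP c). Qed.

Lemma ins_inj u : injective (ins_fun u).
Proof.
rewrite /ins_fun; case: eqP => [_|_] [x|c] [y|d] //.
- case: insubP => [c _ <-|Cx]; case: insubP => [d _ <-|Cy] //.
    by move=> [->].
  by move=> [/perm_inj->].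
- case: insubP => // Cx [/perm_inj e1]; by rewrite e1 (valP d) in Cx.
- case: insubP => // Cx [/perm_inj e1]; by rewrite -e1 (valP c) in Cx.
- by move=> [/perm_inj/val_inj->].
- by move=> [/perm_inj->].
- case: ifP => [uv [/(congr1 val)]|_ [->]] //.
  by rewrite !val_ins // => /perm_inj/val_inj->.
Qed.

Definition ins u : {perm T} := perm (@ins_inj u).

Lemma ins_inl u x : u != v -> ins u (inl x) = inl (act M u x).
Proof. by rewrite permE /ins_fun => /negPf->. Qed.

Lemma ins_inr u c : u != v -> ~~ adj u v -> ins u (inr c) = inr c.
Proof. by rewrite permE /ins_fun => /negPf-> /negPf->. Qed.

Lemma ins_inr_adj u c : adj u v ->
  ins u (inr c) = inr (insubd c (act M u (val c))).
Proof.
move=> uv; rewrite permE /ins_fun uv; case: eqP => // uv'.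
by rewrite uv' adj_irr in uv.
Qed.

Lemma ins_v_C (c : sT) : ins v (inl (val c)) = inr c.
Proof. by rewrite permE /ins_fun eqxx valK. Qed.

Lemma ins_v_notC x : ~~ C x -> ins v (inl x) = inl (act M v x).
Proof. by move=> Cx; rewrite permE /ins_fun eqxx insubN. Qed.

Lemma ins_v_inr c : ins v (inr c) = inl (act M v (val c)).
Proof. by rewrite permE /ins_fun eqxx. Qed.

Lemma ins_comm_v (u : Gr) : adj u v -> commute (ins u) (ins v).
Proof.
move=> uv; have uv' := adj_neq uv.
have act_uv x : act M v (act M u x) = act M u (act M v x).
  by rewrite -!permM (act_comm M uv).
apply/permP=> -[x|c]; rewrite !permM; last first.
  by rewrite ins_inr_adj // !ins_v_inr ins_inl // val_ins // act_uv.
rewrite ins_inl //; have [Cx|Cx] := boolP (C x); last first.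
  by rewrite !ins_v_notC ?C_link // ins_inl // act_uv.
rewrite -[x]/(val (Sub x Cx : sT)) ins_v_C ins_inr_adj // -{1}val_ins //.
by rewrite ins_v_C.
Qed.

Lemma ins_comm (u w : Gr) : adj u w -> commute (ins u) (ins w).
Proof.
move=> uw; have [ev|wv] := eqVneq w v; first by rewrite ev in uw *; apply: ins_comm_v.
have [ev|uv] := eqVneq u v.
  by rewrite ev in uw *; apply/commute_sym/ins_comm_v; rewrite adj_sym.
apply/permP=> -[x|c]; rewrite !permM.
  by rewrite !ins_inl // -!permM (act_comm M uw).
have [auv|nuv] := boolP (adj u v); have [awv|nwv] := boolP (adj w v).
- rewrite !ins_inr_adj //; congr inr; apply: val_inj.
  by rewrite !val_ins // -!permM (act_comm M uw).
- by rewrite !(ins_inr_adj _ auv) !(ins_inr _ wv nwv) ins_inr_adj.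
- by rewrite !(ins_inr_adj _ awv) !(ins_inr _ uv nuv) ins_inr_adj.
- by rewrite !ins_inr.
Qed.

(** The boolean [e] selects the half of a subdivided edge that becomes good: the one into the copy
    if true, the one out of it if false. This good half determines the label of the copy in
    [ins_lab]. *)
Definition ins_good (u : Gr) (z : T) : bool :=
  if u == v then (match z with inl x => if C x then e else good v x | inr c => ~~ e end)
  else (match z with inl x => good u x | inr c => adj u v && good u (val c) end).

Lemma ins_good_act (u w : Gr) z : adj u w -> ins_good w (ins u z) = ins_good w z.
Proof.
rewrite /ins_good => uw; have uw' := adj_neq uw.
have [ev|wv] := eqVneq w v.
  rewrite ev in uw uw'; case: z => [x|c].
    by rewrite ins_inl // C_link // good_act.
  by rewrite ins_inr_adj.
have [ev|uv] := eqVneq u v.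
  rewrite ev in uw *; case: z => [x|c].
    have [Cx|Cx] := boolP (C x); last by rewrite ins_v_notC // good_act.
    by rewrite -[x]/(val (Sub x Cx : sT)) ins_v_C adj_sym uw.
  by rewrite ins_v_inr good_act // adj_sym uw.
case: z => [x|c]; first by rewrite ins_inl // good_act.
have [auv|nuv] := boolP (adj u v); last by rewrite ins_inr.
by rewrite ins_inr_adj // val_ins // good_act.
Qed.

Definition ins_lab (z : T) : set (raag Gr) :=
  match z with
  | inl x => lab x
  | inr c => if e then rtrans (lab (val c)) (raag_gen v)
             else rtrans (lab (act M v (val c))) (raag_gen v)^-1
  end.

Lemma ins_lab_act u z :
  ins_good u z -> ins_lab (ins u z) = rtrans (ins_lab z) (raag_gen u).
Proof.
rewrite /ins_good; have [->|uv] := eqVneq u v.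
  case: z => [x|c].
    have [Cx|Cx] := boolP (C x); last by rewrite ins_v_notC //; apply: lab_act.
    by move=> e1; rewrite -[x]/(val (Sub x Cx : sT)) ins_v_C /= e1.
  by rewrite ins_v_inr /= => /negPf->; rewrite rtransVK.
case: z => [x|c]; first by rewrite ins_inl //; apply: lab_act.
case/andP=> auv gc; rewrite ins_inr_adj //= val_ins //.
have gen_uv := gen_commute auv; case: e.
  by rewrite lab_act // -!rtransM gen_uv.
have -> : act M v (act M u (val c)) = act M u (act M v (val c)).
  by rewrite -!permM (act_comm M auv).
rewrite lab_act ?good_act // 1?adj_sym // -!rtransM; congr rtrans.
exact: commuteV.
Qed.

Lemma ins_trans : transitive_family ins.
Proof.
move=> P Pinv.
have Pl x y : P (inl x) = P (inl y).
  apply: (act_trans (m := M) (P := fun x => P (inl x))) => u {}x.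
  have [->|uv] := eqVneq u v; last by rewrite -(Pinv u (inl x)) ins_inl.
  have [Cx|Cx] := boolP (C x); last by rewrite -(Pinv v (inl x)) ins_v_notC.
  (* For x in C, two steps along v lead through the copy of x to [act M v x]. *)
  rewrite -[x]/(val (Sub x Cx : sT)) -ins_v_inr Pinv -(Pinv v (inl _)).
  by rewrite ins_v_C.
have Pr c x : P (inr c) = P (inl x).
  by rewrite -(Pinv v) ins_v_inr; apply: Pl.
have Pb z : P z = P (inl (base M)) by case: z => [x|c]; [apply: Pl | apply: Pr].
by move=> x y; rewrite (Pb x) (Pb y).
Qed.

Definition insertion : marked_action B :=
  @MarkedAction Gr B _ ins ins_good ins_lab (inl (base M)) ins_comm
    ins_good_act ins_lab_act (lab_base M) ins_trans.

Lemma insertion_inl u x : good u x ->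
  good (m := insertion) u (inl x) /\ act insertion u (inl x) = inl (act M u x).
Proof.
move=> gx /=; rewrite /ins_good; have [ev|uv] := eqVneq u v; last by rewrite ins_inl.
rewrite ev in gx *.
have Cx : ~~ C x by apply: contraL gx; apply: C_bad.
by rewrite (negPf Cx) ins_v_notC.
Qed.

Lemma insertion_extends : extends M insertion.
Proof.
by exists (@inl _ _); split=> //= [x y []//|u x]; apply: insertion_inl.
Qed.

End Insertion.

(** * Extending walks, and points fixed by all generators but one *)

Section Extensions.
Variables (Gr : sgraph) (B : set (raag Gr)).
Implicit Types M N : marked_action B.

(** By induction on the last letter. If it cannot be followed from [y], copies of all starting
    points of bad v-edges are inserted, and the sign of the letter decides which half of the
    subdivided edge must become good. *)
Lemma extend_walk M w : exists2 N, extends M N & exists y, walk (base N) w = Some y.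
Proof.
elim/last_ind: w => [|w [v b] [N MN [y wy]]].
  by exists M; [exact: extends_refl | exists (base M)].
case E: (step y (v, b)) => [z|].
  by exists N => //; exists z; rewrite -cats1 walk_cat wy /= in E *; rewrite E.
pose C := fun x => ~~ good (m := N) v x.
have Clink u x : adj u v -> C (act N u x) = C x by move=> uv; rewrite /C good_act.
have Cbad x : C x -> ~~ good v x by [].
have insW e : walk (M := insertion e Clink) (inl (base N)) w = Some (inl y)
  := walk_extends (insertion_inl e Cbad Clink) wy.
case: b E => /=; case: ifP => // /negbT bad _;
  [exists (insertion true Clink) | exists (insertion false Clink)];
  try exact: extends_trans MN (insertion_extends _ Cbad Clink).
  pose c : {x | C x} := exist (fun x => is_true (C x)) y bad.
  exists (inr c); rewrite -cats1 walk_cat insW /= -[y]/(val c) ins_v_C.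
  by rewrite /ins_good eqxx [C _]bad.
(* For an inverse letter the walk ends in the copy of the v-predecessor of [y]. *)
pose c : {x | C x} := exist (fun x => is_true (C x)) _ bad.
exists (inr c); rewrite -cats1 walk_cat insW /=.
suff -> : (ins Clink v)^-1 (inl y) = inr c by rewrite /ins_good eqxx.
by apply: (@perm_inj _ (ins Clink v)); rewrite permKV ins_v_inr /= permKV.
Qed.

Lemma extend_walks M (ws : seq (word Gr)) : exists2 N, extends M N &
  forall w, w \in ws -> exists y, walk (base N) w = Some y.
Proof.
elim: ws => [|w ws [N MN Nws]]; first by exists M; [exact: extends_refl | ].
have [L NL Lw] := extend_walk N w; exists L; first exact: extends_trans NL.
move=> w'; rewrite inE => /predU1P[->//|/Nws[y wy]].
have [j [jI jb jg]] := NL; exists (j y).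
by rewrite -jb; exact: (walk_extends jg wy).
Qed.

(** If all edges were good, the finitely many labels would be closed under translation by generators
    and exhaust the orbit of B. *)
Lemma bad_edge M :
    ~ (exists s : seq (set (raag Gr)), forall g, rtrans B g \in s) ->
  exists v (x : pt M), ~~ good v x.
Proof.
move=> inf; apply: contrapT => nbad.
have allgood v (x : pt M) : good v x by apply/negP=> /negP bad; apply: nbad; exists v, x.
apply: inf; exists [seq lab x | x <- enum (pt M)] => g.
suff [x ->] : exists x : pt M, rtrans B g = lab x by rewrite map_f ?mem_enum.
elim/raag_ind: g => [|g [v b] [x e]]; first by exists (base M); rewrite rtrans1 lab_base.
rewrite rtransM e; case: b; first by exists (act M v x); rewrite lab_act.
exists ((act M v)^-1 x); rewrite -{1}(permKV (act M v) x) lab_act //.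
by rewrite rtransK.
Qed.

(* D is the set of the copies inserted last, into the cycles of b. As b is not in
   L, any generator a distinct from and not adjacent to b is bad on D, and D can be
   copied along a in turn, which replaces L by its part adjacent to a. *)
Definition layered M (D : pred (pt M)) (b : Gr) (L : pred Gr) :=
  [/\ exists x, D x, forall u, L u -> adj u b,
      forall u x, u != b -> ~~ L u -> D x -> act M u x = x /\ ~~ good u x &
      forall u x, L u -> D (act M u x) = D x].

(** Generators other than v and not adjacent to it fix the new copies and are bad there by
    construction, so only those adjacent to v have to be controlled on C. *)
Lemma layered_insertion M v (C : pred (pt M)) (L : pred Gr)
    (Clink : forall u x, adj u v -> C (act M u x) = C x) :
    (exists x, C x) -> (forall u, L u -> adj u v) ->
    (forall u x, adj u v -> ~~ L u -> C x -> act M u x = x /\ ~~ good u x) ->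
  layered (M := insertion true Clink) (fun z => if z is inr _ then true else false) v L.
Proof.
move=> [x Cx] Lv Ctriv; split=> //.
- by exists (inr (exist _ x Cx)).
- move=> u [//|c] uv nLu _ /=; rewrite /ins_good (negPf uv).
  have [auv|nuv] := boolP (adj u v); last by rewrite ins_inr.
  have [e g] := Ctriv u (val c) auv nLu (valP c); split=> //.
  by rewrite ins_inr_adj //; congr inr; apply: val_inj; rewrite (val_ins Clink).
- move=> u [y|c] /Lv uv /=; last by rewrite ins_inr_adj.
  by rewrite ins_inl // adj_neq.
Qed.

Lemma layered_start M v (x : pt M) : ~~ good v x ->
  exists2 N, extends M N & exists D, layered (M := N) D v (fun u => adj u v).
Proof.
move=> bad; pose C := fun x => ~~ good (m := M) v x.
have Clink u z : adj u v -> C (act M u z) = C z by move=> uv; rewrite /C good_act.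
exists (insertion true Clink); first exact: insertion_extends.
eexists; apply: layered_insertion => //; first by exists x.
by move=> u z ->.
Qed.

Lemma layered_step M D b L a : layered (M := M) D b L -> a != b -> ~~ adj a b ->
  exists2 N, extends M N &
    exists D', layered (M := N) D' a (fun u => L u && adj u a).
Proof.
move=> [exD Lb Dtriv DL] ab nab.
have nLa : ~~ L a by apply: contra nab; apply: Lb.
have neq_b u : adj u a -> u != b.
  by move=> ua; apply: contraNneq nab => <-; rewrite adj_sym.
have Dlink u x : adj u a -> D (act M u x) = D x.
  move=> ua; have [Lu|nLu] := boolP (L u); first exact: DL.
  (* Outside L the generator u fixes D pointwise, so it maps no other point into D. *)
  apply/idP/idP=> Dx; last by have [-> _] := Dtriv u x (neq_b u ua) nLu Dx.
  have [/perm_inj e _] := Dtriv u _ (neq_b u ua) nLu Dx.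
  by rewrite e in Dx.
have Dbad x : D x -> ~~ good a x by move=> Dx; have [] := Dtriv a x ab nLa Dx.
exists (insertion true Dlink); first exact: insertion_extends.
eexists; apply: layered_insertion => //; first by move=> u /andP[].
by move=> u x ua; rewrite ua andbT; apply: Dtriv; apply: neq_b.
Qed.

Definition coadj (u v : Gr) := (u != v) && ~~ adj u v.

(** Each step along the path cuts L down to the neighbours of one more vertex. As no vertex is
    adjacent to itself, L becomes empty once the path covers the graph. *)
Lemma layered_path M v (x : pt M) p : ~~ good v x -> path coadj v p ->
  exists2 N, extends M N & exists D L, layered (M := N) D (last v p) L /\
    forall u, L u -> all (adj u) (v :: p).
Proof.
move=> bad; elim/last_ind: p => [_|p a IHp].
  have [N MN [D DL]] := layered_start bad; exists N => //.
  by exists D, (fun u => adj u v); split=> // u /= ->.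
rewrite rcons_path last_rcons => /andP[/IHp[N MN [D [L [DL Lp]]]] /andP[ab nab]].
have [|| K NK [D' DL']] := layered_step (a := a) DL; rewrite 1?eq_sym 1?adj_sym //.
exists K; first exact: extends_trans NK.
exists D', (fun u => L u && adj u a); split=> // u /andP[/Lp up ua].
by rewrite -rcons_cons all_rcons ua.
Qed.

End Extensions.

(** * The alternating quotient *)

Lemma covering_path (V : eqType) (e : rel V) (ts : seq V) (v : V) :
    (forall u w, exists2 p, path e u p & last u p = w) ->
  exists2 p, path e v p & {subset ts <= v :: p}.
Proof.
move=> conn; elim: ts => [|t ts [p ep sp]]; first by exists [::].
have [q eq lq] := conn (last v p) t; exists (p ++ q); first by rewrite cat_path ep.
move=> z; rewrite inE => /predU1P[->|/sp]; last first.
  by rewrite !inE mem_cat => /orP[]->; rewrite ?orbT.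
by rewrite -lq -last_cat mem_last.
Qed.

Section Alternating.
Variables (Gr : sgraph) (vs : seq Gr).
Hypothesis vsP : forall v : Gr, v \in vs.
Hypothesis coadj_conn : forall u v : Gr, exists2 p, path (@coadj Gr) u p & last u p = v.
Hypothesis two_vertices : exists u v : Gr, u != v.

Lemma coadj_neighbour (b : Gr) : exists a, coadj b a.
Proof.
have [c cb] : exists c : Gr, b != c.
  have [u [w uw]] := two_vertices; have [e|] := eqVneq b u; last by exists u.
  by exists w; rewrite e.
have [[|a p] /=] := coadj_conn b c; first by move=> _ e; rewrite e eqxx in cb.
by case/andP=> ba _ _; exists a.
Qed.

Variables (B : set (raag Gr)) (M : marked_action B).
Hypothesis loops : forall k, rtrans B k = B ->
  exists2 w, word_val w = k & walk (base M) w = Some (base M).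
Hypothesis infinite_orbit :
  ~ (exists s : seq (set (raag Gr)), forall g, rtrans B g \in s).

(** The point [i0] is the base point. The stabilizer of B fixes it because its elements are read
    along closed walks; an element x of s leads to a point with label [rtrans B x], different from
    B. *)
Lemma alternating_quotient (s : seq (raag Gr)) :
    (forall x, x \in s -> rtrans B x <> B) ->
  exists (n : nat) (f : {multiplicative raag Gr -> {perm 'I_n}}) (i0 : 'I_n),
    [/\ range f = [set p | p \in 'Alt_('I_n)],
        forall k, rtrans B k = B -> f k i0 = i0 &
        forall x, x \in s -> f x i0 <> i0].
Proof.
move=> sB; have [N1 MN1 N1w] := extend_walks M [seq repr x | x <- s].
have [v [x bad]] := bad_edge N1 infinite_orbit.
have [p cp sp] := covering_path vs v coadj_conn.
have [N N1N [D [L [[[y Dy] Lb Dtriv _] Lp]]]] := layered_path bad cp.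
set b := last v p in Lb Dtriv.
have nL u : ~~ L u.
  apply/negP=> /Lp /allP /(_ u); rewrite adj_irr => /(_ (sp u (vsP u))).
  by [].
have [a /andP[ba nba]] := coadj_neighbour b.
have ab : a != b by rewrite eq_sym.
have [_ y_bad] := Dtriv a y ab (nL a) Dy.
have [|||T [tau [j [jI tau_comm tau_Alt tau_j tau_gen]]]] :=
  @alternating_extension Gr (@adj Gr) (pt N) (act N) (good (m := N)) y a b
    (@adj_sym Gr) (act_comm N) (act_trans (m := N)) ab.
- by rewrite adj_sym.
- by move=> u ub; have [] := Dtriv u y ub (nL u) Dy.
- by [].
have [f fgen] := raag_lift (K := {perm T}) tau_comm.
have f_walk (z t : pt N) w : walk z w = Some t -> f (word_val w) (j z) = j t.
  elim: w z => [|[u c] w IHw] z /=.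
    move=> [->]; have -> : word_val [::] = 1 :> raag Gr by [].
    by rewrite multiplicative1 perm1.
  rewrite word_val_cons gmulfM permM /letter_val /=.
  case: c; case: ifP => // g /IHw <-; first by rewrite fgen tau_j.
  rewrite multiplicativeV fgen; congr (f _ _); apply: (@perm_inj _ (tau u)).
  by rewrite permKV tau_j // permKV.
have [j1 [j1I j1b j1g]] := extends_trans MN1 N1N.
have [j2 [j2I j2b j2g]] := N1N.
pose rn := perm_rename (@enum_rankK T) (@enum_valK T).
have fr_mul : {morph (fun g => rn (f g)) : g h / g * h}.
  by move=> g h; rewrite gmulfM; apply: perm_renameM.
have [F FE] := morph_multiplicative fr_mul.
exists #|T|, F, (enum_rank (j (base N))); split.
- apply/seteqP; split=> q /=.
    case=> g _ <-; rewrite FE Alt_even perm_rename_odd -Alt_even.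
    elim/raag_ind: g => [|g [u c] fg]; first by rewrite multiplicative1 group1.
    rewrite gmulfM groupM // /letter_val /=; case: c; rewrite ?multiplicativeV ?groupV fgen //.
  rewrite Alt_even => qe.
  (* The image of [f] is a group containing all [tau u], to which [tau_gen] applies. *)
  pose G := [set q : {perm T} | `[< exists g, f g = q >]]%SET.
  have Gg : group_set G.
    apply/group_setP; split; first by rewrite !inE; exists 1; rewrite multiplicative1.
    move=> g h; rewrite !inE => -[g' <-] [h' <-].
    by exists (g' * h'); rewrite gmulfM.
  have AG := tau_gen (group Gg); have /fintype.subsetP AG' : 'Alt_T \subset G.
    apply: AG => u; rewrite !inE; exists (raag_gen u); exact: fgen.
  pose q' := perm_rename (@enum_valK T) (@enum_rankK T) q.
  have : q' \in G by apply: AG'; rewrite Alt_even perm_rename_odd.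
  rewrite !inE => -[g fg]; exists g => //; rewrite FE fg.
  by apply/permP=> i; rewrite -{1}(enum_valK i) !perm_renameE enum_valK.
- move=> k /loops[w <- /(walk_extends j1g)]; rewrite j1b => /f_walk e.
  by rewrite FE perm_renameE e.
- move=> z zs; have [t wt] := N1w (repr z) (map_f _ zs).
  have := walk_extends j2g wt; rewrite j2b => /f_walk; rewrite word_valK => e.
  rewrite FE perm_renameE e => /enum_rank_inj/jI; rewrite -j2b => /j2I tb.
  by apply: (sB z zs); have := lab_walk wt; rewrite tb !lab_base word_valK.
Qed.

End Alternating.

(** * Completion of partial injections *)

Section Completion.
Variables (Gr : sgraph) (Q : seq (set (raag Gr))) (X0 : set (raag Gr)).
Implicit Types (l m : Gr * bool) (w : word Gr).

Definition ltrans (X : set (raag Gr)) l : set (raag Gr) :=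
  rtrans X (letter_val (@raag_gen Gr) l).
Definition linv l : Gr * bool := (l.1, ~~ l.2).

Fixpoint qwalk (X : set (raag Gr)) w : bool :=
  if w is l :: w' then (ltrans X l \in Q) && qwalk (ltrans X l) w' else true.

Hypothesis QX0 : X0 \in Q.
Hypothesis square : forall X l m, X \in Q -> ltrans X l \in Q -> ltrans X m \in Q ->
  adj l.1 m.1 -> ltrans (ltrans X l) m \in Q.
Hypothesis conn : forall X, X \in Q ->
  exists2 w, qwalk X0 w & rtrans X0 (word_val w) = X.

Local Notation pQ := (seq_sub Q).

Lemma linvK : involutive linv.
Proof. by case=> v b; rewrite /linv negbK. Qed.

Lemma ltransK X l : ltrans (ltrans X l) (linv l) = X.
Proof.
by case: l => v []; rewrite /ltrans /letter_val /= ?rtransK ?rtransVK.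
Qed.

Lemma ltransC X l m : adj l.1 m.1 -> ltrans (ltrans X l) m = ltrans (ltrans X m) l.
Proof.
move=> lm; rewrite /ltrans -!rtransM; congr rtrans.
have c := gen_commute lm; case: l m c {lm} => u [] [v []] c //=.
- exact: commuteV.
- exact/commute_sym/commuteV/commute_sym.
- exact/commuteV/commute_sym/commuteV/commute_sym.
Qed.

Definition can_advance l (x : pQ) : bool := ltrans (val x) l \in Q.
(** The default value lets x stand still at the end of a segment. This makes [advance] total, and
    commutation for adjacent letters holds everywhere. *)
Definition advance l (x : pQ) : pQ := insubd x (ltrans (val x) l).

Lemma val_advance l x : can_advance l x -> val (advance l x) = ltrans (val x) l.
Proof. by move=> c; rewrite insubdK. Qed.

Lemma advance_id l x : ~~ can_advance l x -> advance l x = x.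
Proof. by move=> c; rewrite /advance /insubd insubN. Qed.

Lemma can_advanceV l x : can_advance l x -> can_advance (linv l) (advance l x).
Proof. by move=> c; rewrite /can_advance val_advance // ltransK (valP x). Qed.

Lemma advanceK l x : can_advance l x -> advance (linv l) (advance l x) = x.
Proof.
move=> c; apply: val_inj; rewrite val_advance ?can_advanceV // val_advance //.
exact: ltransK.
Qed.

(** Both directions come from [square]: one at x, the other at [advance m x] with the inverse of
    m. *)
Lemma can_advance_advance l m x : adj l.1 m.1 -> can_advance l (advance m x) = can_advance l x.
Proof.
move=> lm; have ml : adj m.1 l.1 by rewrite adj_sym.
have [cm|/advance_id->//] := boolP (can_advance m x).
have Qx : val x \in Q := valP x.
apply/idP/idP=> [c|c]; last by rewrite /can_advance val_advance //; apply: square.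
have := square (valP (advance m x)) (can_advanceV cm) c ml.
by rewrite val_advance // ltransK.
Qed.

Lemma advanceC l m x : adj l.1 m.1 -> advance l (advance m x) = advance m (advance l x).
Proof.
move=> lm; have ml : adj m.1 l.1 by rewrite adj_sym.
have [cl|cl] := boolP (can_advance l x); last first.
  by rewrite (advance_id cl) advance_id // can_advance_advance.
have [cm|cm] := boolP (can_advance m x); last first.
  by rewrite (advance_id cm) [RHS]advance_id // can_advance_advance.
apply: val_inj; rewrite !val_advance ?can_advance_advance //.
exact: ltransC.
Qed.

Local Notation N := #|{: pQ}|.

Lemma can_advance_iter l m n x : adj l.1 m.1 -> can_advance l (iter n (advance m) x) = can_advance l x.
Proof. by move=> lm; elim: n => //= n IHn; rewrite can_advance_advance. Qed.

Lemma advance_iterC l m n x : adj l.1 m.1 ->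
  advance l (iter n (advance m) x) = iter n (advance m) (advance l x).
Proof. by move=> lm; elim: n => //= n <-; rewrite advanceC. Qed.

Lemma iter_advance_id l n x : ~~ can_advance l x -> iter n (advance l) x = x.
Proof. by move=> c; elim: n => //= n ->; apply: advance_id. Qed.

Lemma iter_advanceK l n x : (forall i, i < n -> can_advance l (iter i (advance l) x)) ->
  iter n (advance (linv l)) (iter n (advance l) x) = x.
Proof.
elim: n => // n IHn c; rewrite iterSr /= advanceK ?c //; apply: IHn => i lt_in.
exact/c/ltnW.
Qed.

(* From the end of a segment, #|Q| steps backwards lead to its beginning: a
   longer path would close up and contradict that x is an end. *)
Lemma segment_ends l x : ~~ can_advance l x ->
  ~~ can_advance (linv l) (iter N (advance (linv l)) x) /\
  iter N (advance l) (iter N (advance (linv l)) x) = x.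
Proof.
move=> cx; set l' := linv l; pose y i := iter i (advance l') x.
have [k [kN ck /negP nck]] : exists k, [/\ k <= N,
    forall i, i < k -> can_advance l' (y i) & ~ can_advance l' (y k)].
  have [n /andP[nN cn]] : exists n, (n <= N) && ~~ can_advance l' (y n).
    apply: contrapT => nex.
    have all_can i : i <= N -> can_advance l' (y i).
      by move=> iN; apply/negP=> /negP ci; apply: nex; exists i; rewrite iN.
    have : ~~ injectiveb (fun i : 'I_N.+1 => y i).
      by apply/injectiveP=> /leq_card; rewrite card_ord ltnn.
    case/injectivePn=> i [j]; wlog ltij : i j / (i < j)%N.
      move=> wlg; case: (ltngtP i j) => [lt_ij|lt_ji|/val_inj->]; first exact: wlg.
        by rewrite eq_sym => ji e; apply: wlg ji _.
      by rewrite eqxx.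
    move=> _ yij.
    have back n (k : nat) : (n + k <= N)%N -> iter n (advance l) (y (n + k)%N) = y k.
      move=> nmN; rewrite /y iterD -[l]linvK iter_advanceK // => q qn.
      by rewrite -iterD; apply: all_can; apply: leq_trans nmN; rewrite leq_add2r ltnW.
    have yi : y 0 = y (j - i)%N.
      have jN : j <= N by rewrite -ltnS.
      rewrite -(back i 0) ?addn0; last exact: leq_trans (ltnW ltij) jN.
      by rewrite yij -{1}(subnKC (ltnW ltij)) back // subnKC // ltnW.
    move: (cx); rewrite -[x]/(y 0) yi -(prednK (n := j - i)) ?subn_gt0 //.
    rewrite -{1}[l]linvK /y iterS can_advanceV //; apply: all_can.
    apply: leq_trans (leq_pred _) _; apply: leq_trans (leq_subr _ _) _.
    by rewrite -ltnS.
  have exk : exists n, ~~ can_advance l' (y n) by exists n.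
  exists (ex_minn exk); case: ex_minnP => k ck mink; split; last exact/negP.
    exact: leq_trans (mink _ cn) nN.
  by move=> i ik; apply: contraLR ik => /mink; rewrite -leqNgt.
have yN : y N = y k.
  by rewrite /y -(subnK kN) iterD iter_advance_id.
split; first by rewrite -/(y N) yN.
rewrite -/(y N) yN -(subnK kN) iterD /y -{2}[l]linvK iter_advanceK //.
exact: iter_advance_id.
Qed.

(** The jump from the end of a segment back to its beginning always takes [N] steps, the surplus
    ones standing still. As the number is uniform, the jump commutes with adjacent letters by
    iterating [advanceC]. *)
Definition close l (x : pQ) : pQ :=
  if can_advance l x then advance l x else iter N (advance (linv l)) x.

Lemma closeK l : cancel (close l) (close (linv l)).
Proof.
move=> x; rewrite /close linvK; have [c|c] := boolP (can_advance l x).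
  by rewrite can_advanceV ?advanceK.
by have [/negPf-> ->] := segment_ends c.
Qed.

Lemma can_advance_close l m x : adj l.1 m.1 -> can_advance l (close m x) = can_advance l x.
Proof. by rewrite /close; case: ifP => _ lm; rewrite ?can_advance_advance ?can_advance_iter. Qed.

Lemma close_advanceC l m x : adj l.1 m.1 -> close l (advance m x) = advance m (close l x).
Proof.
move=> lm; rewrite /close can_advance_advance //; case: ifP => _; first exact: advanceC.
by rewrite [RHS]advance_iterC // adj_sym.
Qed.

Lemma closeC l m x : adj l.1 m.1 -> close l (close m x) = close m (close l x).
Proof.
move=> lm; rewrite {2 3}/close can_advance_close 1?adj_sym //.
case: ifP => _; first exact: close_advanceC.
by elim: N => //= n <-; apply: close_advanceC.
Qed.

Definition close_perm (v : Gr) : {perm pQ} := perm (can_inj (closeK (v, true))).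
Definition close_good (v : Gr) : pred pQ := can_advance (v, true).

Lemma close_perm_comm (u v : Gr) : adj u v -> commute (close_perm u) (close_perm v).
Proof.
by move=> uv; apply/permP=> x; rewrite !permM !permE closeC // adj_sym.
Qed.

Lemma close_good_act (u v : Gr) x : adj u v -> close_good v (close_perm u x) = close_good v x.
Proof. by move=> uv; rewrite permE /close_good can_advance_close // adj_sym. Qed.

Lemma close_lab_act v x :
  close_good v x -> val (close_perm v x) = rtrans (val x) (raag_gen v).
Proof. by rewrite permE /close_good /close => c; rewrite c val_advance. Qed.

Lemma close_perm_advance v x : can_advance (v, true) x -> close_perm v x = advance (v, true) x.
Proof. by move=> c; rewrite permE /close c. Qed.

Lemma close_perm_advanceV v x : can_advance (v, false) x ->
  close_good v (advance (v, false) x) /\ close_perm v (advance (v, false) x) = x.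
Proof.
move=> c; have cV := can_advanceV c; split; first exact: cV.
by rewrite close_perm_advance //; apply: advanceK c.
Qed.

Lemma qwalk_inv (P : pred pQ) x w : (forall v x, P (close_perm v x) = P x) ->
  qwalk (val x) w -> exists2 y, val y = rtrans (val x) (word_val w) & P y = P x.
Proof.
move=> Pinv; elim: w x => [|[v b] w IHw] x /=.
  by exists x => //; rewrite [word_val _]/(1 : raag Gr) rtrans1.
case/andP=> c; have cx : can_advance (v, b) x by [].
rewrite -val_advance // => /IHw[y vy Py]; exists y.
  by rewrite vy val_advance // word_val_cons rtransM.
rewrite {}Py; case: b cx {c vy} => cx; first by rewrite -close_perm_advance.
by have [_ {2}<-] := close_perm_advanceV cx; rewrite Pinv.
Qed.

Definition close_base : pQ := SeqSub QX0.

Lemma close_trans : transitive_family close_perm.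
Proof.
move=> P Pinv; suff Pb x : P x = P close_base by move=> x y; rewrite (Pb x) (Pb y).
have [w qw e] := conn (valP x).
have [y vy <-] := qwalk_inv (x := close_base) Pinv qw.
by congr P; apply: val_inj; rewrite vy e.
Qed.

Definition completion : marked_action X0 :=
  @MarkedAction Gr X0 _ close_perm close_good val close_base close_perm_comm
    close_good_act close_lab_act erefl close_trans.

Lemma walk_completion (x : pt completion) w : qwalk (lab x) w ->
  exists y, walk x w = Some y.
Proof.
elim: w x => [|[v b] w IHw] x /=; first by exists x.
case/andP=> c; have cx : can_advance (v, b) x by [].
rewrite -val_advance // => /IHw[y wy]; exists y.
case: b cx wy {c} => cx wy; first by rewrite /close_good cx close_perm_advance.
have [g e] := close_perm_advanceV cx.
have -> : (close_perm v)^-1 x = advance (v, false) x.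
  by apply: (@perm_inj _ (close_perm v)); rewrite permKV e.
by rewrite g.
Qed.

End Completion.

(** * Geodesics in the Salvetti complex *)

Section Cubes.
Variable Gr : sgraph.
Local Notation A := (raag Gr).
Local Notation gen := (@raag_gen Gr).

Lemma cube_vertices0 (g : A) (us : 0.-tuple Gr) : cube_vertices g us = [set g].
Proof.
apply/seteqP; split=> [x [P _ <-]|x -> ] /=; first by rewrite big_pred0 ?mulg1 // => -[].
by exists finset.set0 => //; rewrite big_pred0 ?mulg1 // => -[].
Qed.

Lemma salvetti_vertex (g : A) : salvetti_cube 0 [set g].
Proof. by exists g, [tuple]; split=> //; rewrite cube_vertices0. Qed.

Lemma cube_vertices1 (g : A) (us : 1.-tuple Gr) :
  cube_vertices g us = [set g; g * gen (tnth us ord0)].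
Proof.
have I1 (P : {set 'I_1}) : \prod_(j in P) gen (tnth us j) =
    if ord0 \in P then gen (tnth us ord0) else 1.
  by rewrite big_mkcond big_ord_recl big_ord0 Monoid.mulm1. 
apply/seteqP; split=> [x [P _ <-]|x [->|->]] /=.
- by rewrite I1; case: ifP; [right | left; rewrite mulg1].
- by exists finset.set0 => //; rewrite I1 finset.in_set0 /= mulg1.
- by exists finset.setT => //; rewrite I1 finset.in_setT.
Qed.

Lemma salvetti_edge (y z : A) : salvetti_cube 1 [set y; z] <->
  exists l, z = y * letter_val gen l.
Proof.
split.
  case=> g [us [_ _]]; rewrite cube_vertices1; set u := tnth us ord0 => e.
  have [] : [set y; z] g /\ [set y; z] (g * gen u) by rewrite e; split; [left|right].
  have : [set g; g * gen u] y /\ [set g; g * gen u] z by rewrite -e; split; [left|right].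
  case=> [[yE|yE] [zE|zE]] gE uE.
  - by exists (u, true); rewrite /letter_val /= zE yE; case: uE => ->; rewrite ?yE ?zE.
  - by exists (u, true); rewrite /letter_val /= zE yE.
  - by exists (u, false); rewrite /letter_val /= zE yE mulgK.
  - have yg : y = g by case: gE => [gE|gE]; rewrite [RHS]gE // zE yE.
    by exists (u, true); rewrite /letter_val /= zE yg.
case=> -[u b] ->; case: b; rewrite /letter_val /=.
  exists y, [tuple u]; rewrite cube_vertices1; split=> //.
  by move=> ? ?; rewrite !inE => /eqP-> /eqP->.
exists (y * (gen u)^-1), [tuple u]; rewrite cube_vertices1 mulgVK setUC; split=> //.
by move=> ? ?; rewrite !inE => /eqP-> /eqP->.
Qed.

Lemma edge_path_word (g : A) w : exists2 p, edge_path g p & last g p = g * word_val w.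
Proof.
elim: w g => [|l w IHw] g; first by exists [::]; rewrite //= [word_val _]/(1 : A) mulg1.
have [p pp lp] := IHw (g * letter_val gen l); exists (g * letter_val gen l :: p).
  by rewrite /edge_path /= pp andbT; apply/asboolP/salvetti_edge; exists l.
by rewrite /= lp word_val_cons mulgA.
Qed.

Lemma geodesic_exists (g h : A) : exists2 p, geodesic g p & last g p = h.
Proof.
have [p0 ep0 lp0] := edge_path_word g (repr (g^-1 * h)).
rewrite word_valK mulKVg in lp0.
pose P n := `[< exists p, [/\ edge_path g p, last g p = h & size p = n] >].
have exP : exists n, P n by exists (size p0); apply/asboolP; exists p0.
case: (ex_minnP exP) => n /asboolP[p [ep lp sp]] minn; exists p => //; split=> // q eq lq.
by rewrite sp; apply: minn; apply/asboolP; exists q; rewrite lq.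
Qed.

(* Proved with the morphism to Z/2 that kills all generators but u. *)
Lemma letter_val_neq (u v : Gr) b c : u != v ->
  letter_val gen (u, b) <> letter_val gen (v, c).
Proof.
move=> uv e; pose k (w : Gr) : {perm bool} := if w == u then tperm true false else 1.
have [|f fgen] := raag_lift (k := k).
  by move=> x y _; rewrite /k; do 2!case: ifP => _ //;
     [exact: commute1 | exact/commute_sym/commute1].
have fl w d : f (letter_val gen (w, d)) = k w.
  rewrite /letter_val /=; case: d; rewrite ?multiplicativeV fgen //.
  by rewrite /k; case: ifP; rewrite ?tpermV ?invg1.
have := congr1 f e; rewrite !fl /k eqxx eq_sym (negPf uv) => /permP /(_ true).
by rewrite tpermL perm1.
Qed.

(* Proved with the morphism to Z/2 that maps all generators to 1. *)
Lemma letter_val_parity l1 l2 l3 :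
  letter_val gen l1 * letter_val gen l2 <> letter_val gen l3.
Proof.
move=> e; pose t : {perm bool} := tperm true false.
have [//|f fgen] := raag_lift (Gr := Gr) (k := fun=> t).
have fl l : f (letter_val gen l) = t.
  by case: l => w d; rewrite /letter_val /=; case: d; rewrite ?multiplicativeV fgen ?tpermV.
have := congr1 f e; rewrite gmulfM !fl tperm2 => /permP /(_ true).
by rewrite tpermL perm1.
Qed.

(** The end points are distinct by [letter_val_neq] and not joined by an edge by
    [letter_val_parity], so their distance is 2. Through this geodesic, convexity yields the fourth
    corner of a square. *)
Lemma geodesic_square (g : A) (l m : Gr * bool) : adj l.1 m.1 ->
  geodesic (g * letter_val gen l)
    [:: g * letter_val gen l * letter_val gen m; g * letter_val gen m].
Proof.
move=> lm; have lmC : commute (letter_val gen l) (letter_val gen m).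
  have c := gen_commute lm; case: l m c {lm} => u [] [v []] c //=.
  - exact: commuteV.
  - exact/commute_sym/commuteV/commute_sym.
  - exact/commuteV/commute_sym/commuteV/commute_sym.
split.
  rewrite /edge_path /= andbT; apply/andP; split; apply/asboolP/salvetti_edge.
    by exists m.
  have lV : letter_val gen l * letter_val gen (l.1, ~~ l.2) = 1.
    by case: (l) => u []; rewrite /letter_val /= ?mulgV ?mulVg.
  exists (l.1, ~~ l.2); rewrite -(mulgA g (letter_val gen l)) lmC.
  by rewrite !mulgA -(mulgA _ (letter_val gen l)) lV mulg1.
case=> [|x [|? ?]] //=.
  move=> _ /mulgI; case: l m lm {lmC} => u b [v c] /= uv.
  by have /letter_val_neq neq := adj_neq uv => /neq.
rewrite /edge_path /= andbT => /asboolP/salvetti_edge[k ->].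
by rewrite -mulgA => /mulgI /letter_val_parity.
Qed.

End Cubes.

(** * Convex-cocompact subgroups *)

Section ConvexCocompact.
Variables (Gr : sgraph) (vs : seq Gr).
Hypothesis vsP : forall v : Gr, v \in vs.
Hypothesis coadj_conn : forall u v : Gr, exists2 p, path (@coadj Gr) u p & last u p = v.
Hypothesis two_vertices : exists u v : Gr, u != v.
Local Notation A := (raag Gr).
Local Notation gen := (@raag_gen Gr).
Variables (H : set A).
Hypothesis subH : subgroup H.

Lemma subgroup1 : H 1.
Proof. by case: subH => H1 _; rewrite inE in H1. Qed.

Lemma subgroupV x : H x -> H x^-1.
Proof.
by move=> Hx; have := group_closedV subH; move=> /(_ x); rewrite !inE => /(_ Hx).
Qed.

Lemma subgroupM x y : H x -> H y -> H (x * y).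
Proof.
move=> Hx Hy; have := group_closedM subH; move=> /(_ x y).
by rewrite !inE => /(_ Hx Hy).
Qed.

Lemma rtrans_subgroup g h : rtrans H g = rtrans H h <-> H (h * g^-1).
Proof.
split=> [e|Hhg].
  have : rtrans H h h by rewrite /rtrans /= mulgV; exact: subgroup1.
  by rewrite -e.
apply: funext => x; apply/propext; rewrite /rtrans /mkset; split=> Hx.
  have -> : x * h^-1 = (x * g^-1) * (h * g^-1)^-1 by rewrite invMg invgK mulgA mulgVK.
  by apply: subgroupM => //; apply: subgroupV.
have -> : x * g^-1 = (x * h^-1) * (h * g^-1) by rewrite mulgA mulgVK.
exact: subgroupM.
Qed.

(** Inversion exchanges the right cosets used here with the left cosets counted by
    [infinite_index]. *)
Lemma infinite_index_rtrans g0 : infinite_index H ->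
  ~ (exists s : seq (set A), forall g, rtrans (rtrans H g0) g \in s).
Proof.
move=> inf [s sP]; apply: inf.
apply: (@sub_finite_set _ _ [set [set x | X x^-1] | X in [set` s]]).
  move=> _ [g _ <-] /=; exists (rtrans H g^-1).
    by rewrite /= -(mulKVg g0 g^-1) rtransM; apply: sP.
  apply/seteqP; split=> [x|x [h Hh <-]]; rewrite /rtrans /= invgK.
    move=> Hx; exists (g^-1 * x); last by rewrite mulKVg.
    by rewrite -[g^-1 * x]invgK; apply: subgroupV; rewrite invMg invgK.
  by rewrite invMg mulgVK; apply: subgroupV.
by apply: finite_image; apply: finite_seq.
Qed.

Variable Y : set (set A).
Hypotheses (Y_neq0 : Y !=set0) (Ysub : subcomplex Y) (Yconv : convex Y).
Hypotheses (Yinv : invariant_under H Y) (Ycoc : acts_cocompactly H Y).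

Local Notation S := [set g : A | Y [set g]].

Lemma S_inhabited : exists g, S g.
Proof.
have [C YC] := Y_neq0; have [n [g [us [_ _ Cdef]]]] := Ysub.1 C YC.
exists g; apply: (Ysub.2 0 C) => //; first exact: salvetti_vertex.
move=> _ ->; rewrite Cdef; exists finset.set0 => //.
by rewrite big_pred0 ?mulg1 // => j; rewrite finset.in_set0.
Qed.

Lemma S_invariant h g : H h -> S g -> S (h * g).
Proof.
move=> Hh Sg; have := Yinv Hh Sg; rewrite /translate /=.
suff -> : [set h * x | x in [set g]] = [set h * g] by [].
by apply/seteqP; split=> [_ [_ -> <-]//|_ ->]; exists g.
Qed.

Lemma S_square g l m : adj l.1 m.1 -> S (g * letter_val gen l) ->
  S (g * letter_val gen m) -> S (g * letter_val gen l * letter_val gen m).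
Proof.
move=> lm Sl Sm; have [Sall _] := Yconv (geodesic_square g lm) Sl Sm.
by apply: Sall; rewrite !inE eqxx orbT.
Qed.

Lemma S_connected g h : S g -> S h -> exists2 w, g * word_val w = h &
  forall w1 w2, w = w1 ++ w2 -> S (g * word_val w1).
Proof.
move=> Sg Sh; have [p gp lp] := geodesic_exists g h.
have := Yconv gp Sg; rewrite lp => /(_ Sh)[Sp _].
case: gp => [ep _]; elim: p g Sg ep lp Sp => [|x p IHp] g Sg /=.
  move=> _ <- _; exists [::]; first by rewrite [word_val _]/(1 : A) mulg1.
  by case=> // w2 _; rewrite [word_val _]/(1 : A) mulg1.
rewrite /edge_path /= => /andP[/asboolP/salvetti_edge[l xE] ep] lp Sp.
have Sx : S x by apply: Sp; rewrite !inE eqxx orbT.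
have [|w we wS] := IHp x Sx ep lp.
  by move=> y yp; apply: Sp; rewrite in_cons yp orbT.
exists (l :: w); first by rewrite word_val_cons mulgA -xE.
case=> [|l' w1] w2; first by move=> _; rewrite [word_val _]/(1 : A) mulg1.
by case=> <- /wS; rewrite word_val_cons mulgA -xE.
Qed.

(** The union of the H-orbit of the vertex g is the coset [H g], so finitely many orbits of cubes
    leave finitely many such cosets. *)
Lemma finite_quotient : exists Q : seq (set A),
  forall X, X \in Q <-> exists2 g, S g & X = rtrans H g.
Proof.
have fin : finite_set [set rtrans H g | g in S].
  apply: (@sub_finite_set _ _
    [set \bigcup_(D in O) D | O in [set [set translate k C | k in H] | C in Y]]).
    move=> _ [g Sg <-]; exists [set translate k [set g] | k in H]; first by exists [set g].
    apply/seteqP; split=> x.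
      by move=> [_ [k Hk <-]] [_ -> <-]; rewrite /rtrans /= mulgK.
    rewrite /rtrans /= => Hx; exists (translate (x * g^-1) [set g]); first by exists (x * g^-1).
    by exists g => //; rewrite mulgVK.
  exact: finite_image.
have /finite_seqP[Q QE] := fin; exists Q => X.
have -> : (X \in Q) = [set` Q] X :> Prop by [].
by rewrite -QE; split=> [[g Sg <-]|[g Sg ->]]; exists g.
Qed.

Lemma convex_cocompact_alternating_separable :
  infinite_index H -> alternating_separable H.
Proof.
move=> inf s sH; have [g0 Sg0] := S_inhabited; have [Q QP] := finite_quotient.
set X0 := rtrans H g0.
have QX0 : X0 \in Q by apply/QP; exists g0.
(* S is invariant under H, so a coset in Q has all its representatives in S. *)
have Qtrans g l : ltrans (rtrans H g) l \in Q -> S (g * letter_val gen l).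
  rewrite /ltrans -rtransM => /QP[h Sh /esym/rtrans_subgroup Hh].
  by rewrite -(mulgVK h (g * _)); apply: S_invariant.
have square X l m : X \in Q -> ltrans X l \in Q -> ltrans X m \in Q ->
    adj l.1 m.1 -> ltrans (ltrans X l) m \in Q.
  move=> /QP[g Sg ->] /Qtrans Sl /Qtrans Sm lm; apply/QP.
  exists (g * letter_val gen l * letter_val gen m); first exact: S_square.
  by rewrite /ltrans !rtransM.
have Swalk g w : (forall w1 w2, w = w1 ++ w2 -> S (g * word_val w1)) ->
    qwalk Q (rtrans H g) w.
  elim: w g => //= l w IHw g gS; rewrite /ltrans -rtransM.
  have Sgl : S (g * letter_val gen l).
    by have := gS [:: l] w erefl; rewrite word_val_letter.
  apply/andP; split; first by apply/QP; exists (g * letter_val gen l).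
  apply: IHw => w1 w2 e; have := gS (l :: w1) w2; rewrite e word_val_cons mulgA.
  by apply.
have conn X : X \in Q -> exists2 w, qwalk Q X0 w & rtrans X0 (word_val w) = X.
  move=> /QP[g Sg ->]; have [w wg wS] := S_connected Sg0 Sg.
  by exists w; [exact: Swalk | rewrite -rtransM wg].
pose M := completion QX0 square conn.
have loops k : rtrans X0 k = X0 ->
    exists2 w, word_val w = k & walk (base M) w = Some (base M).
  move=> kX0; have Sg0k : S (g0 * k).
    rewrite -[g0 * k](mulgVK g0); apply: S_invariant => //.
    by apply/rtrans_subgroup; rewrite rtransM -/X0 kX0.
  have [w wg wS] := S_connected Sg0 Sg0k; move/mulgI: wg => wg.
  exists w => //; have [y wy] := walk_completion (x := base M) (Swalk _ _ wS).
  rewrite wy; congr Some; apply: val_inj; have := lab_walk wy.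
  by rewrite wg (lab_base M) kX0.
(* The base coset is [H g0], as 1 may lie outside S. Its stabilizer is the conjugate of H by [g0],
   so the given elements are conjugated likewise. *)
pose conj x := g0^-1 * x * g0.
have [|n [f [i0 [fr fH fs]]]] := alternating_quotient vsP coadj_conn two_vertices
    loops (infinite_index_rtrans inf) (s := [seq conj x | x <- s]).
  move=> _ /mapP[x xs ->] e; apply: (sH x xs); rewrite -(mulgK g0 x).
  have : rtrans H (g0 * conj x) = rtrans H g0 by rewrite rtransM.
  by rewrite /conj !mulgA mulgV mul1g => /esym/rtrans_subgroup.
exists n, f; split=> // x xs [h Hh fhx].
have := fs (conj x) (map_f _ xs); rewrite /conj !gmulfM -fhx -!gmulfM; apply.
apply: fH; rewrite /X0 -rtransM !mulgA mulgV mul1g; apply/esym/rtrans_subgroup.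
by rewrite mulgK.
Qed.

End ConvexCocompact.

(** * Components of the complement graph *)

(** If v occurred in no representative of a generating set, the morphism to Z/2 that kills all
    generators but v would be trivial on that set, hence everywhere, but not at v. *)
Lemma finitely_generated_vertices (Gr : sgraph) :
  finitely_generated (raag Gr) -> exists vs : seq Gr, forall v : Gr, v \in vs.
Proof.
case=> s gens; exists (flatten [seq [seq l.1 | l <- repr x] | x <- s]) => v.
apply/negPn/negP=> nv.
pose k (w : Gr) : {perm bool} := if w == v then tperm true false else 1.
have [|f fgen] := raag_lift (k := k).
  by move=> x y _; rewrite /k; do 2!case: ifP => _ //;
     [exact: commute1 | exact/commute_sym/commute1].
pose H := [set x | f x = 1].
have HT : H = setT.
  apply: gens => [|x xs].
    split; first by rewrite inE /H /= multiplicative1.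
    move=> x y; rewrite !inE /H /= => fx fy.
    by rewrite gmulfM multiplicativeV fx fy invg1 mulg1.
  rewrite /H /= -(word_valK x).
  have : v \notin [seq l.1 | l <- repr x].
    apply: contra nv => vx; apply/flattenP; exists [seq l.1 | l <- repr x] => //.
    exact: map_f.
  elim: (repr x) => [|[u b] w IHw] /=.
    by rewrite [word_val _]/(1 : raag Gr) multiplicative1.
  rewrite inE negb_or => /andP[vu /IHw fw]; rewrite word_val_cons gmulfM fw mulg1.
  rewrite /letter_val /=; case: b; rewrite ?multiplicativeV fgen /k eq_sym (negPf vu) //.
  exact: invg1.
have : H (raag_gen v) by rewrite HT.
rewrite /H /= fgen /k eqxx => /permP /(_ true); by rewrite tpermL perm1.
Qed.

Lemma prodg_only1 (K : groupType) (n : nat) (a : 'I_n -> K) j :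
  (forall i, i != j -> a i = 1) -> \prod_(i < n) a i = a j.
Proof.
move=> a1; transitivity (\prod_(i < n | i == j) a i); last exact: big_pred1_eq.
by rewrite [RHS]big_mkcond; apply: eq_bigr => i _; case: eqVneq => [->|/a1].
Qed.

Section Components.
Variables (Gr : sgraph) (n : nat) (comp : Gr -> 'I_n).
Hypothesis comp_coadj : forall u v : Gr, coadj u v -> comp u = comp v.
Local Notation A := (raag Gr).

Definition comp_adj (i : 'I_n) (u v : {v : Gr | comp v == i}) := adj (val u) (val v).
Lemma comp_adj_sym i : symmetric (@comp_adj i).
Proof. by move=> u v; apply: adj_sym. Qed.
Lemma comp_adj_irr i : irreflexive (@comp_adj i).
Proof. by move=> u; apply: adj_irr. Qed.
Definition comp_graph i : sgraph := SGraph (@comp_adj_sym i) (@comp_adj_irr i).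

Definition comp_gen i (v : Gr) : raag (comp_graph i) :=
  if insub v is Some u then raag_gen (u : comp_graph i) else 1.

Lemma comp_gen_val i (u : comp_graph i) : comp_gen i (val u) = raag_gen u.
Proof. by rewrite /comp_gen valK. Qed.

Lemma comp_gen_out i v : comp v != i -> comp_gen i v = 1.
Proof. by move=> vi; rewrite /comp_gen insubN. Qed.

Lemma comp_proj i : exists p : {multiplicative A -> raag (comp_graph i)},
  forall v, p (raag_gen v) = comp_gen i v.
Proof.
apply: raag_lift => u v uv; rewrite /comp_gen.
case: insubP => [u' _ uE|_]; last exact/commute_sym/commute1.
case: insubP => [v' _ vE|_]; last exact: commute1.
by apply: gen_commute; rewrite /= /comp_adj uE vE.
Qed.

Lemma comp_inj i : exists q : {multiplicative raag (comp_graph i) -> A},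
  forall u : comp_graph i, q (raag_gen u) = raag_gen (val u).
Proof. by apply: raag_lift => u v uv; apply: gen_commute. Qed.

(** The projections [P i] kill the generators outside component i, and the inclusions [I i] split
    them. Vertices of different components are adjacent, so the images of the inclusions commute,
    and the product of the inclusions is inverse to the map given by all projections. *)
Lemma raag_components :
  isomorphic A (group_product (fun i : 'I_n => raag (comp_graph i))).
Proof.
pose P i := projT1 (cid (comp_proj i)); pose I i := projT1 (cid (comp_inj i)).
have Pgen i v : P i (raag_gen v) = comp_gen i v := projT2 (cid (comp_proj i)) v.
have Igen i (u : comp_graph i) : I i (raag_gen u) = raag_gen (val u) :=
  projT2 (cid (comp_inj i)) u.
have PI i x : P i (I i x) = x.
  elim/raag_ind: x => [|x [u b] IHx]; first by rewrite !multiplicative1.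
  rewrite !gmulfM IHx; congr (_ * _); rewrite /letter_val /=; case: b.
    by rewrite Igen Pgen comp_gen_val.
  by rewrite !multiplicativeV Igen Pgen comp_gen_val.
have PI1 i j x : i != j -> P j (I i x) = 1.
  move=> ij; elim/raag_ind: x => [|x [u b] IHx]; first by rewrite !multiplicative1.
  have Pu : P j (raag_gen (val u)) = 1.
    by rewrite Pgen comp_gen_out // (eqP (valP u)).
  rewrite !gmulfM IHx mul1g /letter_val /=; case: b; rewrite ?multiplicativeV Igen Pu //.
  exact: invg1.
have Icomm i j x y : i != j -> commute (I i x) (I j y).
  move=> ij; elim/raag_ind: x => [|x l IHx].
    by rewrite multiplicative1; apply/commute_sym/commute1.
  rewrite gmulfM; apply/commute_sym/commuteM; apply/commute_sym => {x IHx} //.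
  elim/raag_ind: y => [|y m IHy]; first by rewrite multiplicative1; apply: commute1.
  rewrite gmulfM; apply: commuteM => {y IHy} //.
  have c (u : comp_graph i) (v : comp_graph j) :
      commute (I i (raag_gen u)) (I j (raag_gen v)).
    rewrite !Igen; apply: gen_commute; apply: contraNT ij => nuv; apply/eqP.
    have [uv|uv] := eqVneq (val u) (val v).
      by rewrite -(eqP (valP u)) -(eqP (valP v)) uv.
    rewrite -(eqP (valP u)) -(eqP (valP v)); apply: comp_coadj.
    by rewrite /coadj uv.
  case: l m => u [] [v []]; rewrite /letter_val /= ?multiplicativeV.
  - exact: c.
  - exact/commuteV/c.
  - exact/commute_sym/commuteV/commute_sym/c.
  - exact/commuteV/commute_sym/commuteV/commute_sym/c.
have FM : {morph (fun x => (fun i => P i x) :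
    group_product (fun i : 'I_n => raag (comp_graph i))) : x y / x * y}.
  by move=> x y; apply: functional_extensionality_dep => i; apply: gmulfM.
have [F FE] := morph_multiplicative FM.
pose psi (x : group_product (fun i : 'I_n => raag (comp_graph i))) : A :=
  \prod_(i < n) I i (x i).
have psiM x y : psi (x * y) = psi x * psi y.
  rewrite /psi; elim: (index_enum _) (index_enum_uniq 'I_n) => [|i r IHr] /=.
    by rewrite !big_nil mulg1.
  case/andP=> ir /IHr {}IHr; rewrite !big_cons IHr.
  have -> : (x * y) i = x i * y i by [].
  rewrite gmulfM -!mulgA; congr (_ * _); rewrite !mulgA; congr (_ * _).
  (* [I i (y i)] moves past the product over [r], since [i] is not in [r]. *)
  rewrite -[LHS]/(_ * _) ; elim: r ir {IHr} => [|j r IHr]; first by rewrite big_nil mulg1 mul1g.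
  rewrite inE negb_or big_cons => /andP[ij /IHr e].
  by rewrite mulgA (Icomm i j) // -!mulgA e.
have psiP x j : P j (psi x) = x j.
  rewrite /psi (big_morph (P j) (@gmulfM _ _ (P j)) (multiplicative1 (P j))).
  by rewrite (prodg_only1 (j := j)) => [|i ij]; [exact: PI | exact: PI1].
have psi1 : psi 1 = 1.
  by rewrite /psi big1 // => i _; exact: (multiplicative1 (I i)).
have psiF x : psi (F x) = x.
  elim/raag_ind: x => [|x [v b] IHx]; first by rewrite multiplicative1 psi1.
  have psiFv : psi (F (raag_gen v)) = raag_gen v.
    rewrite /psi FE (prodg_only1 (j := comp v)) => [|i iv].
      pose u : comp_graph (comp v) := exist (fun w => comp w == comp v) v (eqxx _).
      by rewrite Pgen -[v]/(val u) comp_gen_val Igen.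
    by rewrite Pgen comp_gen_out 1?eq_sym // multiplicative1.
  rewrite gmulfM psiM IHx; congr (_ * _); rewrite /letter_val /=; case: b => //.
  by apply: (mulgI (raag_gen v)); rewrite -{1}psiFv -psiM -gmulfM !mulgV multiplicative1.
exists F; exists psi => // x; apply: functional_extensionality_dep => j.
by rewrite FE psiP.
Qed.

Lemma comp_connected i :
    (forall u v, comp u = comp v -> exists2 p, path (@coadj Gr) u p & last u p = v) ->
  forall u v : comp_graph i, exists2 p, path (@coadj (comp_graph i)) u p & last u p = v.
Proof.
move=> conn u v; have [p pp lp] : exists2 p, path (@coadj Gr) (val u) p &
    last (val u) p = val v.
  by apply: conn; rewrite (eqP (valP u)) (eqP (valP v)).
elim: p u pp lp => [|w p IHp] u /=; first by move=> _ /val_inj ->; exists [::].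
case/andP=> uw pp lp; have wi : comp w == i by rewrite -(comp_coadj uw) (valP u).
pose w' : comp_graph i := exist (fun w => comp w == i) w wi.
have [q qp lq] := IHp w' pp lp; exists (w' :: q) => //=.
by rewrite qp andbT.
Qed.

End Components.

Lemma cyclic_raag (Gr : sgraph) : ~ (exists u v : Gr, u != v) -> cyclic_group (raag Gr).
Proof.
move=> one; have [x xP] : exists x : raag Gr, forall v, raag_gen v = x.
  (* Without vertices the group is trivial, and 1 generates it. *)
  have [[u _]|nov] := pselect (exists u : Gr, True); last first.
    by exists 1 => v; case: nov; exists v.
  exists (raag_gen u) => v; have [->//|uv] := eqVneq v u.
  by case: one; exists v, u.
exists x; elim/raag_ind => [|y [v b] [n IHy]]; first by exists 0; left.
rewrite /letter_val /= xP; case: IHy => ->; case: b.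
- by exists n.+1; left; rewrite expgSr.
- case: n => [|n]; first by exists 1%N; right; rewrite mul1g.
  by exists n; left; rewrite expgSr mulgK.
- case: n => [|n]; first by exists 1%N; left; rewrite invg1 mul1g.
  by exists n; right; rewrite expgS invMg mulgVK.
- by exists n.+1; right; rewrite expgS invMg.
Qed.

Lemma coadj_components (Gr : sgraph) (vs : seq Gr) : (forall v, v \in vs) ->
  exists (n : nat) (comp : Gr -> 'I_n),
    (forall u v, coadj u v -> comp u = comp v) /\
    forall u v, comp u = comp v -> exists2 p, path (@coadj Gr) u p & last u p = v.
Proof.
move=> vsP; pose T := seq_sub vs; pose t v : T := SeqSub (vsP v).
pose e : rel T := fun x y => coadj (val x) (val y).
have e_sym : connect_sym e.
  by apply: sym_connect_sym => x y; rewrite /e /coadj eq_sym adj_sym.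
(* A component is numbered by the rank of its root. Ranks of other points give empty graphs, hence
   trivial factors, which are cyclic. *)
exists #|{: T}|, (fun v => enum_rank (root e (t v))); split=> [u v uv|u v].
  by congr enum_rank; apply/(rootP e_sym)/connect1.
move=> /enum_rank_inj/(rootP e_sym)/connectP[p ep lp].
exists [seq val x | x <- p].
  by rewrite -[u]/(val (t u)) path_map.
by rewrite -[u]/(val (t u)) last_map -lp.
Qed.

Theorem corollaryC (Gr : sgraph) :
  finitely_generated (raag Gr) ->
  exists (n : nat) (F : 'I_n -> groupType),
    isomorphic (raag Gr) (group_product F) /\
    forall i : 'I_n,
      cyclic_group (F i) \/
      exists Gr' : sgraph,
        isomorphic (F i) (raag Gr') /\
        forall H : set (raag Gr'),
          subgroup H -> infinite_index H -> convex_cocompact H ->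
          alternating_separable H.
Proof.
move=> /finitely_generated_vertices[vs vsP].
have [n [comp [comp_coadj conn]]] := coadj_components vsP.
exists n, (fun i => raag (comp_graph comp i)); split; first exact: raag_components.
move=> i; have [two|] := pselect (exists u v : comp_graph comp i, u != v); last first.
  by left; apply: cyclic_raag.
right; exists (comp_graph comp i); split.
  have [f fE] := morph_multiplicative (f := @id (raag (comp_graph comp i))) (fun x y => erefl).
  by exists f; exists id => x; rewrite fE.
move=> H subH inf [Y [Y0 Ysub Yconv Yinv Ycoc]].
have vsiP (u : comp_graph comp i) : u \in pmap insub vs.
  by rewrite mem_pmap_sub.
apply: (convex_cocompact_alternating_separable vsiP (comp_connected comp_coadj conn)
  two subH Y0 Ysub Yconv Yinv Ycoc inf).
Qed.
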